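(* Let $X \subset \Sigma^{\mathbb{Z}^2}$ be a two-dimensional subshift with $X \neq \{0^{\mathbb{Z}^2}\}$ whose (horizontal) trace $Y$ satisfies one of the following: (i) every point in $Y$ is eventually zero to the right (i.e. for each $y \in Y$, $y_i = 0$ for all large enough $i$), or (ii) $Y$ is countable, and the only periodic point in $Y$ is $0^{\mathbb{Z}}$. Then $X$ contains a nonzero finite point, a highway, or a cluster fractal whose trace is sparse.
   Context: A ($\mathbb{Z}^d$-)subshift is a nonempty closed shift-invariant subset of $\Sigma^{\mathbb{Z}^d}$ (product topology), where $\sigma^{\mathbf v}(x)_{\mathbf u} = x_{\mathbf u + \mathbf v}$ and $\Sigma \ni 0$ is a finite alphabet; symbols other than $0$ are nonzero, and the support of a configuration is its set of nonzero cells. The (horizontal) trace of a $\mathbb{Z}^2$-subshift $X$ is the set of all $y \in \Sigma^{\mathbb{Z}}$ such that for some $x \in X$, $i \in \mathbb{Z}$, $y_j = x_{(j,i)}$ for all $j$. A one-dimensional subshift is sparse if each of its configurations has only finitely many nonzero symbols. The trace of a configuration is the trace of its orbit closure. A finite point is a configuration with finite support. Highways. On $\mathbb{Z}^d$ use $d(\mathbf u,\mathbf v) = \max_i |\mathbf u_i - \mathbf v_i|$. An $r$-path in $\mathbb{Z}^2$ is a function $p : \mathbb{Z} \to \mathbb{Z}^2$ with $p(0) = \mathbf 0$ and $d(p(i+1),p(i)) \le r$ for all $i$. It is ascending if, writing $p'(i)$ for the second coordinate of $p(i)$, there is $m \in \mathbb{N}$ such that $p'(j+m+1) - p'(j) >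 0$ for all $j \in \mathbb{Z}$. A configuration $x$ is a highway if for some $r$, some ascending $r$-path $p$ and some $\mathbf v \in \mathbb{Z}^2$, the support of $x$ equals $\{\mathbf v + p(i) : i \in \mathbb{Z}\}$ and the colored path $i \mapsto (p(i), x_{\mathbf v + p(i)})$ is uniformly recurrent, i.e. in the bi-infinite sequence $i \mapsto (p(i+1)-p(i), x_{\mathbf v + p(i)})$ every finite subword that occurs does so with bounded gaps. Cluster fractals. $B_r(S)$ is the set of cells at distance at most $r$ from $S$. A pattern is a function $P : D(P) \to \Sigma$ with $D(P) \subset \mathbb{Z}^d$; its support $S(P)$ is the set of cells of $D(P)$ where $P$ is nonzero. A set $S$ is $r$-connected if the graph on $S$ with edges between cells at distance at most $r$ is connected. $P$ is $r$-padded if $D(P) \supset B_r(S(P))$. An $r$-cluster is an $r$-padded pattern (with nonempty support) whose support is $r$-connected and all of whose zero cells are at distance at most $r$ from the support. $R$ is a zero-gluing of patterns $P$, $Q$ if $D(R) = D(P)\cup D(Q)$, $R|_{D(P)} = P$, $R|_{D(Q)} = Q$, and $P$, $Q$ are both $0$ on $D(P)\cap D(Q)$ (similarly for finitely many patterns). $P|_{\mathbb{Z}^d}$ is the configuration agreeing with $P$ on $D(P)$ and $0$ elsewhere. A configuration $x \in \Sigma^{\mathbb{Z}^d}$ is a cluster fractal if it is not all-zero and there are $r_1 < r_2 < \cdots$ in $\mathbb{N}$ and, for each $i$, a finite set $B_i$ of finite $r_i$-clusters such that for all $i$: (1) each cluster in $B_{i+1}$ is obtained by zero-gluing translates of clusters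 in $B_i$ and adding the $r_{i+1}$-padding by zeroes; (2) each cluster in $B_{i+1}$ contains a translate of every cluster in $B_i$; (3) each cluster in $B_{i+1}$ contains at least two translates of clusters in $B_i$ with disjoint supports; and (4) $x = \lim_{j\to\infty} \sigma^{\mathbf v_j}(b_j|_{\mathbb{Z}^d})$ for some sequences $\mathbf v_j \in \mathbb{Z}^d$, $b_j \in B_j$. *)

(* Defs.v *)
From HB Require Import structures.
From mathcomp Require Import all_boot all_order all_algebra.
From mathcomp Require Import all_classical topology.

Set Implicit Arguments.
Unset Strict Implicit.
Unset Printing Implicit Defensive.

Import Order.TTheory GRing.Theory Num.Theory.
Local Open Scope classical_set_scope.
Local Open Scope ring_scope.

(* Throughout, the alphabet is a finite type
   Sigma and o : Sigma is its zero symbol. *)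

Notation Zd d := 'rV[int]_d.

Definition conf (d : nat) (Sigma : finType) :=
  prod_topology (fun _ : Zd d => discrete_topology Sigma).

(* Used for configurations, for rows in Sigma^Z (G := int), and for patterns,
   where it translates the domain along with the values. *)
Definition shift (G : zmodType) (A : Type) (v : G) (x : G -> A) : G -> A :=
  fun u => x (u + v).

Definition zero_conf (d : nat) (Sigma : finType) (o : Sigma) : conf d Sigma :=
  fun=> o.
Arguments zero_conf d%_N {Sigma} o.

Definition is_subshift (d : nat) (Sigma : finType) (X : set (conf d Sigma)) :=
  [/\ X !=set0, closed X & forall v x, X x -> X (shift v x)].

Definition orbit_closure (d : nat) (Sigma : finType) (x : conf d Sigma) :
  set (conf d Sigma) := closure (range (fun v => shift v x : conf d Sigma)).

Definition support (G : Type) (Sigma : finType) (o : Sigma) (x : G -> Sigma) :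
  set G := [set u | x u <> o].

Definition cell (j i : int) : Zd 2 := \row_(k < 2) (if k == 0 then j else i).

Definition trace (Sigma : finType) (X : set (conf 2 Sigma)) :
  set (int -> Sigma) :=
  [set y | exists2 x, X x & exists i, forall j, y j = x (cell j i)].

Definition sparse (Sigma : finType) (o : Sigma) (Y : set (int -> Sigma)) :=
  forall y, Y y -> finite_set (support o y).

Definition eventually_zero_right (Sigma : finType) (o : Sigma)
    (y : int -> Sigma) :=
  exists N : int, forall i, N <= i -> y i = o.

Definition periodic (A : Type) (y : int -> A) :=
  exists2 p : int, p != 0 & shift p y = y.

Definition finite_point (d : nat) (Sigma : finType) (o : Sigma)
    (x : conf d Sigma) := finite_set (support o x).

Definition dist (d : nat) (u v : Zd d) : nat :=
  \max_(i < d) `|u ord0 i - v ord0 i|%N.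

Definition r_path (r : nat) (p : int -> Zd 2) :=
  p 0 = 0 /\ forall i, (dist (p (i + 1)) (p i) <= r)%N.

Definition ascending (p : int -> Zd 2) :=
  exists m : nat, forall j : int,
    0 < p (j + m%:Z + 1) ord0 (1 : 'I_2) - p j ord0 (1 : 'I_2).

(* The subword of s of length n at position a recurs with gaps bounded by N. *)
Definition uniformly_recurrent (A : Type) (s : int -> A) :=
  forall (a : int) (n : nat), exists N : nat, forall b : int,
    exists2 c : int, b <= c <= b + N%:Z &
      forall k : nat, (k < n)%N -> s (c + k%:Z) = s (a + k%:Z).

Definition highway (Sigma : finType) (o : Sigma) (x : conf 2 Sigma) :=
  exists (r : nat) (p : int -> Zd 2) (v : Zd 2),
    [/\ r_path r p, ascending p,
        support o x = range (fun i => v + p i) &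
        uniformly_recurrent (fun i => (p (i + 1) - p i, x (v + p i)))].

(* A pattern P with domain D(P) is encoded by P u = None for u outside D(P). *)
Definition pattern (d : nat) (Sigma : finType) := Zd d -> option Sigma.

Section Patterns.
Context (d : nat) (Sigma : finType) (o : Sigma).
Implicit Types (P Q R : pattern d Sigma) (S : set (Zd d)) (r : nat).

Definition dom P : set (Zd d) := [set u | P u <> None].

Definition psupport P : set (Zd d) := [set u | dom P u /\ P u <> Some o].

Definition nbhd r S : set (Zd d) :=
  [set u | exists2 w, S w & (dist u w <= r)%N].

Definition r_connected r S :=
  forall u v, S u -> S v ->
    exists q : seq (Zd d),
      [/\ path (fun a b => dist a b <= r)%N u q, last u q = v &
          forall w, w \in q -> S w].

Definition r_padded r P := nbhd r (psupport P) `<=` dom P.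

Definition r_cluster r P :=
  [/\ r_padded r P, psupport P !=set0, r_connected r (psupport P) &
      forall u, P u = Some o -> nbhd r (psupport P) u].

(* P is the restriction of R to the domain of P. *)
Definition subpattern P R := forall u, dom P u -> R u = P u.

Definition zero_gluing (n : nat) (P : 'I_n -> pattern d Sigma) R :=
  [/\ dom R = \bigcup_(k in [set: 'I_n]) dom (P k),
      forall k, subpattern (P k) R &
      forall k l u, k != l -> dom (P k) u -> dom (P l) u ->
        P k u = Some o /\ P l u = Some o].

Definition is_translate P Q := exists v, Q = shift v P.

Definition zero_padding r P : pattern d Sigma := fun u =>
  if P u is Some a then Some a
  else if `[< nbhd r (psupport P) u >] then Some o else None.

Definition zero_extension P : conf d Sigma := fun u => odflt o (P u).

Definition contains_translate P R :=
  exists2 Q, is_translate P Q & subpattern Q R.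

Definition cluster_fractal (x : conf d Sigma) :=
  x <> zero_conf d o /\
  exists (r : nat -> nat) (B : nat -> set (pattern d Sigma)),
    [/\ forall i, (r i < r i.+1)%N,
        forall i, finite_set (B i) /\
          forall C, B i C -> r_cluster (r i) C /\ finite_set (dom C) &
        [/\ forall i C, B i.+1 C ->
              exists (n : nat) (P : 'I_n -> pattern d Sigma) R,
                [/\ forall k, exists2 b, B i b & is_translate b (P k),
                    zero_gluing P R & C = zero_padding (r i.+1) R],
            forall i C b, B i.+1 C -> B i b -> contains_translate b C,
            forall i C, B i.+1 C ->
              exists Q1 Q2,
                [/\ exists2 b, B i b & is_translate b Q1,
                    exists2 b, B i b & is_translate b Q2,
                    subpattern Q1 C, subpattern Q2 C &
                    psupport Q1 `&` psupport Q2 = set0] &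
            exists (v : nat -> Zd d) (b : nat -> pattern d Sigma),
              (forall j, B j (b j)) /\
              (fun j => shift (v j) (zero_extension (b j)) : conf d Sigma)
                @ \oo --> x]].

End Patterns.

(* Main.v *)
Require Import Defs.
From mathcomp Require Import all_boot all_order all_algebra zify.
From mathcomp Require Import all_classical topology.
Local Open Scope classical_set_scope.

(** Every nonzero subshift contains a minimal nonzero one, [M]: by compactness
    of the cylinder of configurations that are nonzero at the origin, a chain of
    nonzero subshifts has a nonzero intersection, so Zorn's lemma applies
    ([exists_minimal_nonzero]).  Such an [M] may contain the zero configuration,
    but it is recurrent relative to its nonzero cells: each pattern of [M] occurs
    at bounded distance from each nonzero cell of each configuration of [M]
    ([minimal_recurrence]).  The whole proof takes place inside [M].

    The rows of [M] are finite ([minimal_sparse]).  If one row were infinite, the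
    pigeonhole principle applied to the vertical offsets given by recurrence would
    produce, for each pattern, a row in which that pattern occurs infinitely often.
    Choosing such occurrences again and again and passing to the limit
    ([minimal_fusion]) yields, when rows are eventually zero to the right, a row
    with infinitely many nonzero symbols to the right and, when the trace is
    countable without nonzero periodic point, a row that differs from all members of
    the countable trace; periodicity is excluded because two occurrences that
    cannot be told apart make the row periodic.

    Finite rows give clean strips ([exists_clean_strip]): for each height there is
    a nonzero pattern all of whose occurrences carry every nonzero cell of the
    horizontal strip around them.  Otherwise patterns could be extended forever by
    new cells of the strip, and the limit would have an infinite row.

    Suppose now that [M] has no nonzero finite point.  Connect nonzero cells at
    distance at most [r].

    If for each [r] the components are uniformly bounded, the [r]-clusters around
    the origin of the configurations of [M], taken along a sequence of fast growing
    radii, witness that every configuration of [M] that is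
    nonzero at the origin is a cluster fractal ([minimal_cluster_fractal]): growing
    radii collect a copy of each smaller cluster by recurrence, and a second
    component because there is no finite point.

    If for some [r] the components are unbounded, take clean strips of height at
    least [r].  They lie near every nonzero cell, and a connected set can pass such
    a strip only through its bounded content.  Hence markers at equal heights are
    close to each other, a connected set confined to a horizontal strip has bounded
    width ([conn_width]), long components are tall, and all nonzero cells at a
    height crossed by a tall component lie close to it ([crossing_width]).  A limit
    is a configuration whose nonzero cells form a single thick curve crossing all
    heights ([exists_strand]).  Listing, for each height, the nonzero cells of a
    thin strip from its leftmost column on gives an ascending path.  The list
    depends only on the local pattern, so recurrence of [M] makes the coloured path
    uniformly recurrent ([strand_highway]). *)

Set Implicit Arguments.
Unset Strict Implicit.
Unset Printing Implicit Defensive.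
Import Order.TTheory GRing.Theory Num.Theory.

(** * The maximum metric and boxes *)

Section Metric.
Local Open Scope ring_scope.
Context (d : nat).
Implicit Types u v w : Zd d.

Lemma dist_leP u v n :
  reflect (forall i, (`|u ord0 i - v ord0 i| <= n)%N) (dist u v <= n)%N.
Proof. by apply: (iffP (bigmax_leqP _ _ _)) => h i => [|_]; exact: h. Qed.

Lemma dist_coord u v i : (`|u ord0 i - v ord0 i| <= dist u v)%N.
Proof. by have /dist_leP := leqnn (dist u v). Qed.

Lemma distC u v : dist u v = dist v u.
Proof. by apply: eq_bigr => i _; lia. Qed.

Lemma distxx u : dist u u = 0%N.
Proof. by apply/eqP; rewrite -leqn0; apply/dist_leP => i; lia. Qed.

Lemma dist_triangle v u w : (dist u w <= dist u v + dist v w)%N.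
Proof.
apply/dist_leP => i; have := dist_coord u v i; have := dist_coord v w i; lia.
Qed.

Lemma dist_add w u v : dist (u + w) (v + w) = dist u v.
Proof. by apply: eq_bigr => i _; rewrite !mxE opprD addrACA subrr addr0. Qed.

Lemma dist_sub u v : dist u v = dist (u - v) 0.
Proof. by rewrite -(dist_add (- v)) subrr. Qed.

Lemma finite_box n : finite_set [set u : Zd d | (dist u 0 <= n)%N].
Proof.
pose g (f : {ffun 'I_d -> 'I_(n.*2.+1)}) : Zd d :=
  \row_(i < d) ((f i)%:Z - n%:Z).
apply: (@sub_finite_set _ _ (range g)); last exact/finite_image/finite_finset.
move=> u /= /dist_leP hu.
exists [ffun i => inord (absz (u ord0 i + n%:Z))] => //.
apply/rowP => i; rewrite mxE ffunE.
have hi : (absz (u ord0 i) <= n)%N by have := hu i; rewrite mxE subr0.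
by move: (u ord0 i) hi => a {}hi; rewrite inordK; clear g u hu; lia.
Qed.

Lemma finite_ball v n : finite_set [set u : Zd d | (dist u v <= n)%N].
Proof.
apply: (@sub_finite_set _ _ ((fun u => u + v) @` [set u : Zd d | (dist u 0 <= n)%N])).
  by move=> u /= h; exists (u - v); rewrite /= -?dist_sub // subrK.
exact/finite_image/finite_box.
Qed.

Lemma finite_bounded (A : set (Zd d)) :
  finite_set A -> exists n, forall u, A u -> (dist u 0 <= n)%N.
Proof.
move=> /finite_seqP[s ->]; exists (\max_(u <- s) dist u 0)%N => u /= us.
exact: (@leq_bigmax_seq _ _ xpredT (fun u => dist u 0)).
Qed.

End Metric.

(** * Compactness of configuration space *)

Section Configurations.
Local Open Scope ring_scope.
Context (d : nat) (Sigma : finType).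
Implicit Types (x z : conf d Sigma) (X : set (conf d Sigma)).

Definition agree n x z := forall c : Zd d, (dist c 0 <= n)%N -> x c = z c.

Lemma agree_sym n x z : agree n x z -> agree n z x.
Proof. by move=> h c /h. Qed.

Lemma agree_trans n x y z : agree n x y -> agree n y z -> agree n x z.
Proof. by move=> h1 h2 c hc; rewrite h1 // h2. Qed.

Lemma agree_le n m x z : (n <= m)%N -> agree m x z -> agree n x z.
Proof. by move=> nm h c hc; apply: h; exact: leq_trans nm. Qed.

Lemma agree_shift m n v x z :
  (dist v 0 + n <= m)%N -> agree m x z -> agree n (shift v x) (shift v z).
Proof.
move=> h a c hc; apply: a; apply: leq_trans h.
rewrite (leq_trans (dist_triangle v _ _)) // [dist (c + v) v]dist_sub addrK.
by rewrite addnC leq_add2l.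
Qed.

Lemma shift0 x : shift 0 x = x.
Proof. by apply/funext => u; rewrite /shift addr0. Qed.

Lemma shift_shift u v x : shift u (shift v x) = shift (u + v) x.
Proof. by apply/funext => w; rewrite /shift addrA. Qed.

(** A box is finite, so its cylinder is a finite intersection of open sets. *)
Lemma nbhs_agree n x : nbhs x [set z | agree n x z].
Proof.
have [s hs] := (finite_seqP _).1 (finite_box d n).
have E c : (dist c 0 <= n)%N <-> c \in s.
  by move/seteqP: hs => [h1 h2]; split; [exact: h1|exact: h2].
have -> : [set z | agree n x z] = [set z | forall c, c \in s -> x c = z c].
  by apply/seteqP; split => z /= h c /E; exact: h.
elim: s {hs E} => [|c s IH]; first exact: (@nearW _ (nbhs x)).
have hc : nbhs x [set z : conf d Sigma | x c = z c].
  have h := @proj_continuous (Zd d) (fun _ => discrete_topology Sigma) c x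
    [set x c] (@discrete_set1 (discrete_topology Sigma) (x c)).
  apply: (@filterS _ (nbhs x) _ (fun z => [set x c] (z c))) h => z /= ->.
  by [].
apply: (@filterS _ (nbhs x)) (filterI hc IH) => z /= [h1 h2] e.
by rewrite in_cons => /predU1P[->//|/h2].
Qed.

(** The box cylinders generate the neighbourhood filter of the product
    topology, so closedness can be tested on boxes. *)
Lemma closed_agree X x : closed X ->
  (forall n, exists2 z, X z & agree n x z) -> X x.
Proof.
move=> cX h; apply: cX => B.
move=> Bx; suff [n hn] : exists n, [set z | agree n x z] `<=` B.
  by have [z Xz /hn] := h n; exists z.
have : (filter_from setT (fun n => [set z | agree n x z])) --> x.
  have F : Filter (filter_from setT (fun n => [set z | agree n x z])).
    apply: filter_from_filter; first by exists 0%N.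
    move=> i j _ _; exists (maxn i j) => // z /= hz; split; apply: agree_le hz.
      exact: leq_maxl.
    exact: leq_maxr.
  apply/cvg_sup => c; apply/cvg_image.
    by apply/seteqP; split => // a _; exists (fun=> a).
  move=> A /= /nbhs_singleton Ax.
  exists [set z : conf d Sigma | A (z c)].
    exists (dist c 0) => // z /= hz; rewrite -hz //.
  by apply/seteqP; split=> [a [z ? <-//]|a Aa]; exists (fun=> a).
by move=> /(_ B Bx)[n _ hn]; exists n.
Qed.

Lemma cvg_agree (u : nat -> conf d Sigma) x :
  (forall n, agree n x (u n)) ->
  u @ \oo --> x.
Proof.
move=> h; apply/cvg_sup => c; apply/cvg_image.
  by apply/seteqP; split => // a _; exists (fun=> a).
move=> A /= /nbhs_singleton Ax.
exists [set z : conf d Sigma | A (z c)].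
  exists (dist c 0) => // n /= hn; rewrite -(h n) //.
by apply/seteqP; split=> [a [z ? <-//]|a Aa]; exists (fun=> a).
Qed.

Lemma compact_conf : compact [set: conf d Sigma].
Proof.
have := @tychonoff (Zd d) (fun _ => discrete_topology Sigma) (fun=> setT).
have -> : [set f : Zd d -> discrete_topology Sigma | forall i, setT (f i)] = setT.
  by apply/seteqP; split.
apply => i; apply: finite_compact.
exact: (@finite_finset Sigma).
Qed.

(** Compactness is used through this form of diagonal extraction: the
    limit shares each of its boxes with arbitrarily late members of the sequence. *)
Lemma sequence_limit X (u : nat -> conf d Sigma) :
  closed X -> (forall n, X (u n)) ->
  exists2 x, X x & forall n, exists2 m, (n <= m)%N & agree n x (u m).
Proof.
move=> cX Xu.
have [x [_ hx]] := compact_conf (fmap_proper_filter u eventually_filter) filterT.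
have H n : exists2 m, (n <= m)%N & agree n x (u m).
  have := hx (u @` [set m | (n <= m)%N]) _ _ (nbhs_agree n x).
  case; first by exists n => // m /= hm; exists m.
  by move=> _ [[m hm <-] a]; exists m.
exists x => //; apply: closed_agree => // n.
by have [m _ a] := H n; exists (u m).
Qed.

End Configurations.

(** * Minimal nonzero subshifts *)

Section Minimal.
Local Open Scope ring_scope.
Context (d : nat) (Sigma : finType) (o : Sigma).
Implicit Types (x z : conf d Sigma) (X : set (conf d Sigma)).

(** By shift invariance, being nonzero somewhere and being nonzero at the
    origin amount to the same; the latter is a closed condition, which is what
    survives in limits. *)
Definition nonzero_subshift X :=
  [/\ closed X, forall v x, X x -> X (shift v x) & exists2 x, X x & x 0 <> o].

Definition minimal_nonzero X :=
  nonzero_subshift X /\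
  forall X', X' `<=` X -> nonzero_subshift X' -> X `<=` X'.

(** Zorn's lemma is applied to the complements inside [X].  A chain of
    nonzero subshifts traces, on the compact cylinder of configurations nonzero at
    the origin, a proper filter of closed sets; a cluster point of it lies in all
    of them. *)
Lemma exists_minimal_nonzero X : is_subshift X -> X <> [set zero_conf d o] ->
  exists2 M, M `<=` X & minimal_nonzero M.
Proof.
move=> [[x0 Xx0] cX sX] X0.
have nzX : nonzero_subshift X.
  split=> //; apply: contrapT => hz.
  have Z x : X x -> x = zero_conf d o.
    move=> Xx; apply/funext => u; apply: contrapT => xu; apply: hz.
    by exists (shift u x); [exact: sX|rewrite /shift add0r].
  apply: X0; apply/seteqP; split=> [x /Z //|x -> ].
  by rewrite -(Z _ Xx0).
pose P U := nonzero_subshift (X `\` U).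
have [F FP Fchain|U [PU Umax]] := @Zorn_bigcup _ P.
  rewrite /P.
  have [[U0 FU0]|F0] := pselect (F !=set0); last first.
    suff -> : X `\` \bigcup_(U in F) U = X by [].
    by apply/seteqP; split=> [x []//|x Xx]; split=> // -[U FU]; case: F0; exists U.
  have E : X `\` \bigcup_(U in F) U = \bigcap_(U in F) (X `\` U).
    apply/seteqP; split=> [x [Xx h] U FU|x h].
      by split=> // Ux; apply: h; exists U.
    split; first by case: (h _ FU0).
    by move=> [U FU Ux]; case: (h _ FU).
  rewrite E; split.
  - by apply: closed_bigI => U /FP[].
  - by move=> v x h U FU; case: (FP _ FU) => _ + _; apply; exact: h.
  pose G := filter_from F (fun U => [set x | (X `\` U) x /\ x 0 <> o]).
  have GF : ProperFilter G.
    apply: filter_from_proper; last first.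
      by move=> U /FP[_ _ [x ? ?]]; exists x.
    apply: filter_from_filter; first by exists U0.
    move=> U V FU FV; have [UV|VU] := Fchain _ _ FU FV.
      exists V => // x [[Xx Vx] x0']; do ![split=> //].
      by move=> /UV.
    exists U => // x [[Xx Ux] x0']; do ![split=> //].
    by move=> /VU.
  have [x [_ hx]] := compact_conf GF filterT.
  have h U : F U -> (X `\` U) x /\ x 0 <> o.
    move=> FU; split.
      have [cU _ _] := FP _ FU; apply: cU => B /(hx _ _ _).
      by apply; exists U => // z [].
    have [] := hx [set z | (X `\` U) z /\ z 0 <> o] _ _ (nbhs_agree 0 x).
      by exists U.
    by move=> z [[_ z0] a]; rewrite a // distxx.
  by exists x; [move=> U /h[]|have [] := h _ FU0].
exists (X `\` U); first by move=> x [].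
split=> // X' X'U nzX'.
have E' : X `\` ~` X' = X'.
  by rewrite setDE setCK setIC; apply/setIidl => x /X'U[].
have UX' : U `<=` ~` X' by move=> x Ux /X'U[].
have [EU|NU] := pselect (U = ~` X').
  by rewrite EU E'.
case: (Umax (~` X')); first by split=> // h; apply: NU; apply/seteqP.
by rewrite /P E'.
Qed.

Context (M : set (conf d Sigma)) (hM : minimal_nonzero M).

Lemma minimal_closed : closed M. Proof. by case: hM => [[]]. Qed.

Lemma minimal_shift v x : M x -> M (shift v x).
Proof. by case: hM => [[_ h _] _]; exact: h. Qed.

Lemma minimal_nontrivial : exists2 x, M x & x 0 <> o.
Proof. by case: hM => [[]]. Qed.

Lemma minimal_limit (u : nat -> conf d Sigma) : (forall n, M (u n)) ->
  exists2 x, M x & forall n, exists2 m, (n <= m)%N & agree n x (u m).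
Proof. exact/sequence_limit/minimal_closed. Qed.

(** The configurations of [M] that avoid a pattern of [M] form a smaller
    subshift, which by minimality contains no nonzero configuration. *)
Lemma minimal_occurs z x n : M z -> M x -> x 0 <> o ->
  exists u, agree n (shift u x) z.
Proof.
move=> Mz Mx x0; apply: contrapT => hx.
pose X' := [set x' | M x' /\ forall u, ~ agree n (shift u x') z].
suff nz : nonzero_subshift X'.
  have XM : X' `<=` M by move=> ? [].
  by have [_ /(_ 0)] := hM.2 X' XM nz z Mz; apply; rewrite shift0.
split.
- move=> y cy; split.
    apply: minimal_closed => B /cy[w [[Mw _] Bw]]; by exists w.
  move=> u hu.
  have [w [[_ /(_ u) hw] a]] := cy _ (nbhs_agree (dist u 0 + n) y).
  apply: hw; apply: agree_trans hu; apply: agree_sym.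
  exact: agree_shift a.
- move=> v y [My hy]; split; first exact: minimal_shift.
  by move=> u; rewrite shift_shift; exact: hy.
- exists x => //; split=> // u hu; apply: hx; by exists u.
Qed.

(** Compactness makes the distance in [minimal_occurs] uniform, first over
    the configurations searched and then over the pattern searched for. *)
Lemma minimal_recurrence n : exists R, forall z x, M z -> M x -> x 0 <> o ->
  exists2 u, (dist u 0 <= R)%N & agree n (shift u x) z.
Proof.
have step z : M z -> exists R, forall x, M x -> x 0 <> o ->
    exists2 u, (dist u 0 <= R)%N & agree n (shift u x) z.
  move=> Mz; apply: contrapT => /forallNP h.
  have /choice[w hw] : forall R, exists x, [/\ M x, x 0 <> o &
      forall u, (dist u 0 <= R)%N -> ~ agree n (shift u x) z].
    move=> R; have /existsNP[x /not_implyP[Mx /not_implyP[x0 hx]]] := h R.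
    exists x; split=> // u uR a; apply: hx; by exists u.
  have [x Mx hx] := @minimal_limit w (fun k => let: And3 a _ _ := hw k in a).
  have x0 : x 0 <> o.
    by have [m _ a] := hx 0%N; rewrite a ?distxx //; case: (hw m).
  have [u hu] := @minimal_occurs z x n Mz Mx x0.
  have [m lem a] := hx (dist u 0 + n)%N.
  have [_ _ /(_ u)] := hw m; apply; first by apply: leq_trans lem; exact: leq_addr.
  by apply: agree_trans hu; apply: agree_sym; apply: agree_shift a.
apply: contrapT => /forallNP h.
have /choice[w hw] : forall R, exists z, M z /\ exists x, [/\ M x, x 0 <> o &
      forall u, (dist u 0 <= R)%N -> ~ agree n (shift u x) z].
  move=> R; have /existsNP[z /existsNP[x]] := h R.
  move=> /not_implyP[Mz /not_implyP[Mx /not_implyP[x0 hx]]].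
  by exists z; split=> //; exists x; split=> // u uR a; apply: hx; exists u.
have [z Mz hz] := @minimal_limit w (fun k => (hw k).1).
have [R hR] := step z Mz.
have [m lem a] := hz (maxn R n).
have [_ [x [Mx x0 hx]]] := hw m.
have [u uR hu] := hR x Mx x0.
apply: (hx u).
  by apply: leq_trans uR _; apply: leq_trans lem; exact: leq_maxl.
by apply: agree_trans hu _; apply: agree_le a; exact: leq_maxr.
Qed.

(** A fusion argument: if each pattern around a nonzero origin extends to
    one achieving the local requirement [D k], then a single configuration of [M]
    achieves all of them. *)
Lemma minimal_fusion (D : nat -> conf d Sigma -> nat -> Prop) :
  (forall k z z' n, agree n z z' -> D k z n -> D k z' n) ->
  (forall k z n, M z -> z 0 <> o -> exists z' n',
     [/\ M z', agree n z z', (n < n')%N & D k z' n']) ->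
  exists2 x, M x & forall k, exists2 n, (k < n)%N & D k x n.
Proof.
move=> Dloc Dstep.
have [z0 Mz0 z00] := minimal_nontrivial.
pose T := {p : conf d Sigma * nat | M p.1 /\ p.1 0 <> o}.
have next k (p : T) : exists q : T,
    [/\ agree (sval p).2 (sval p).1 (sval q).1, ((sval p).2 < (sval q).2)%N &
        D k (sval q).1 (sval q).2].
  case: p => [[z n] [/= Mz z0']].
  have [z' [n' [Mz' a nn' Dk]]] := Dstep k z n Mz z0'.
  have z'0 : z' 0 <> o by rewrite -a ?distxx.
  by exists (exist _ (z', n') (conj Mz' z'0)).
have /choice[f hf] : forall kp : nat * T, exists q : T,
    [/\ agree (sval kp.2).2 (sval kp.2).1 (sval q).1,
        ((sval kp.2).2 < (sval q).2)%N & D kp.1 (sval q).1 (sval q).2].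
  by move=> [k p]; exact: next.
pose s := fix s k : T :=
  if k is k'.+1 then f (k', s k') else exist _ (z0, 0%N) (conj Mz0 z00).
pose z k := (sval (s k)).1; pose n k := (sval (s k)).2.
have ns k : (n k < n k.+1)%N by have [] := hf (k, s k).
have nk k : (k <= n k)%N by elim: k => // k IH; apply: leq_ltn_trans (ns k).
have mono k m : (k <= m)%N -> (n k <= n m)%N /\ agree (n k) (z k) (z m).
  elim: m => [|m IH]; first by rewrite leqn0 => /eqP->.
  rewrite leq_eqVlt => /predU1P[->//|]; rewrite ltnS => /IH[h1 h2].
  split; first by apply: leq_trans h1 _; exact: ltnW.
  apply: agree_trans h2 _; apply: (agree_le h1).
  by have [] := hf (m, s m).
have [x Mx hx] := @minimal_limit z (fun k => (proj2_sig (s k)).1).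
exists x => // k; exists (n k.+1); first exact: leq_ltn_trans (nk k) (ns k).
have Dk : D k (z k.+1) (n k.+1) by have [] := hf (k, s k).
have [m lem a] := hx (maxn k.+1 (n k.+1)).
apply: Dloc Dk.
have km : (k.+1 <= m)%N by apply: leq_trans lem; exact: leq_maxl.
apply: agree_trans (mono _ _ km).2 _.
by apply: agree_sym; apply: agree_le a; exact: leq_maxr.
Qed.

End Minimal.

(** * Planar cells *)

Section Plane.
Local Open Scope ring_scope.
Implicit Types u v w : Zd 2.

Definition xco u : int := u ord0 (0 : 'I_2).
Definition yco u : int := u ord0 (1 : 'I_2).

Lemma xcoD u v : xco (u + v) = xco u + xco v. Proof. exact: mxE. Qed.
Lemma ycoD u v : yco (u + v) = yco u + yco v. Proof. exact: mxE. Qed.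
Lemma xcoN u : xco (- u) = - xco u. Proof. exact: mxE. Qed.
Lemma ycoN u : yco (- u) = - yco u. Proof. exact: mxE. Qed.
Lemma xco0 : xco 0 = 0. Proof. exact: mxE. Qed.
Lemma yco0 : yco 0 = 0. Proof. exact: mxE. Qed.
Lemma xco_cell j i : xco (cell j i) = j. Proof. exact: mxE. Qed.
Lemma yco_cell j i : yco (cell j i) = i. Proof. exact: mxE. Qed.

Definition coE := (xcoD, ycoD, xcoN, ycoN, xco0, yco0, xco_cell, yco_cell).

Lemma eq_cell u v : xco u = xco v -> yco u = yco v -> u = v.
Proof.
move=> hx hy; apply/rowP => i.
case: (ord0 =P i) => [<- //|hi].
suff -> : i = 1 by [].
by apply/val_inj; move: i hi => [[|[|k]]] //= h []; apply/val_inj.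
Qed.

Lemma cell_xyco u : cell (xco u) (yco u) = u.
Proof. by apply: eq_cell; rewrite !coE. Qed.

Lemma dist2_leE u v n : (dist u v <= n)%N =
  (`|(xco u - xco v)%R| <= n)%N && (`|(yco u - yco v)%R| <= n)%N.
Proof.
apply/dist_leP/andP => [h|[hx hy] i]; first by split; exact: h.
case: (ord0 =P i) => [<- //|hi].
suff -> : i = 1 by [].
by apply/val_inj; move: i hi => [[|[|k]]] //= h []; apply/val_inj.
Qed.

End Plane.

Lemma finite_int_ball (a : int) (n : nat) :
  finite_set [set b : int | (`|(b - a)%R| <= n)%N].
Proof.
pose g (i : 'I_(n.*2.+1)) : int := (a + i%:Z - n%:Z)%R.
apply: (@sub_finite_set _ _ (range g)); last exact/finite_image/finite_finset.
move=> b /= h; have hb : (absz (b - a + n%:Z)%R < n.*2.+1)%N by lia.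
exists (Ordinal hb) => //; rewrite /g /=; clear g; lia.
Qed.

Lemma infinite_int_gap (A : set int) (n : nat) : ~ finite_set A ->
  exists a b : int, [/\ A a, A b & (a + n%:Z < b)%R].
Proof.
move=> iA; have [a Aa] : A !=set0.
  by apply/set0P/eqP => A0; apply: iA; rewrite A0.
apply: contrapT => h; apply: iA.
apply: (sub_finite_set _ (finite_int_ball a n)) => b Ab /=.
apply: contrapT => hb; apply: h.
have [ab|ba] := ltP a b; first by exists a, b; split=> //; lia.
by exists b, a; split=> //; lia.
Qed.

(** * Rows of a minimal nonzero subshift are finite *)

Section SparseTrace.
Local Open Scope ring_scope.
Context (Sigma : finType) (o : Sigma) (M : set (conf 2 Sigma)).
Context (hM : minimal_nonzero o M).
Implicit Types (x z : conf 2 Sigma).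

Let row0 x : int -> Sigma := fun j => x (cell j 0).

Lemma trace_row0 x : M x -> trace M (row0 x).
Proof. by move=> Mx; exists x => //; exists 0. Qed.

Lemma traceE y : trace M y -> exists2 x, M x & y = row0 x.
Proof.
move=> [x Mx [i hi]]; exists (shift (cell 0 i) x).
  exact: (minimal_shift hM).
apply/funext => j; rewrite hi /row0 /shift; congr x.
by apply: eq_cell; rewrite !coE ?addr0 ?add0r.
Qed.

(** Near each nonzero cell of the infinite row the pattern occurs at a
    vertical offset from a fixed finite range, so some fixed row of the same
    configuration receives infinitely many occurrences. *)
Lemma infinite_row_recurrence x z n : M x -> ~ finite_set (Defs.support o (row0 x)) ->
  M z -> exists2 x', M x' & ~ finite_set [set a | agree n (shift (cell a 0) x') z].
Proof.
move=> Mx ix Mz; have [R hR] := minimal_recurrence hM n.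
apply: contrapT => h; apply: ix.
pose O b := [set a | agree n (shift (cell a 0) (shift (cell 0 b) x)) z].
have fO b : finite_set (O b).
  apply: contrapT => iO; apply: h; exists (shift (cell 0 b) x) => //.
  exact: (minimal_shift hM).
apply: (@sub_finite_set _ _ (\bigcup_(u in [set u : Zd 2 | (dist u 0 <= R)%N])
   [set a - xco u | a in O (yco u)])); last first.
  by apply: bigcup_finite => [|u _]; [exact: finite_box|exact: finite_image].
move=> j /= hj.
have [||u uR a] := hR z (shift (cell j 0) x) Mz.
- exact: (minimal_shift hM).
- by rewrite /shift add0r.
exists u => //; exists (j + xco u); last by rewrite addrK.
move: a; rewrite /O /= !shift_shift; congr (agree n (shift _ x) z).
by apply: eq_cell; rewrite !coE; lia.
Qed.

Context (hY : (forall y, trace M y -> eventually_zero_right o y) \/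
  (countable (trace M) /\ forall y, trace M y -> periodic y -> y = fun=> o)).

(** An infinite row would give rows with two distant occurrences [a < b] of
    any chosen pattern.  Under the first hypothesis, centring at [a] keeps the
    pattern and adds a nonzero cell to its right, and the fusion has a row that is
    not eventually zero.  Under the second, the rows centred at [a] and at [b]
    cannot both equal the point of index [k] of the trace, as the row would then be
    periodic, hence zero; the fusion therefore escapes every point of the trace. *)
Lemma minimal_sparse : sparse o (trace M).
Proof.
move=> y0 /traceE[x0 Mx0 ->]; apply: contrapT => ix0.
have occ z n N : M z -> exists x (a b : int), [/\ M x,
    agree n (shift (cell a 0) x) z, agree n (shift (cell b 0) x) z &
    a + N%:Z < b].
  move=> Mz; have [x Mx ix] := infinite_row_recurrence n Mx0 ix0 Mz.
  by have [a [b [? ? ?]]] := infinite_int_gap N ix; exists x, a, b.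
case: hY => [ez|[/countable_injP[f finj] per]].
- pose D k z n := exists j : int,
    [/\ k%:Z < j, (absz j <= n)%N & z (cell j 0) <> o].
  have [||x Mx hx] := @minimal_fusion _ _ _ _ hM D.
  + move=> k z z' n a [j [h1 h2 h3]]; exists j; split=> //.
    by rewrite -a // dist2_leE !coE; lia.
  + move=> k z n Mz z0.
    have [x [a [b [Mx ha hb ab]]]] := occ z n (maxn k n) Mz.
    exists (shift (cell a 0) x), (absz (b - a)); split.
    * exact: (minimal_shift hM).
    * exact: agree_sym.
    * lia.
    exists (b - a); split; [lia|lia|].
    have := hb 0; rewrite distxx => /(_ isT).
    rewrite /shift add0r.
    have -> : cell (b - a) 0 + cell a 0 = cell b 0.
      by apply: eq_cell; rewrite !coE; lia.
    by move=> ->.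
  have [N hN] := ez _ (trace_row0 Mx).
  have [n _ [j [kj _ xj]]] := hx (absz N).
  by apply: xj; apply: (hN j); lia.
pose D k z n := forall y, trace M y -> f y = k ->
  exists2 j : int, (absz j <= n)%N & z (cell j 0) <> y j.
have [||x Mx hx] := @minimal_fusion _ _ _ _ hM D.
- move=> k z z' n a h y ty fy; have [j jn zj] := h y ty fy.
  by exists j => //; rewrite -a // dist2_leE !coE; lia.
- move=> k z n Mz z0.
  have [[y ty fy]|nk] := pselect (exists2 y, trace M y & f y = k); last first.
    exists z, n.+1; split=> // y ty fy; case: nk; by exists y.
  have Dk z' : (exists j, z' (cell j 0) <> y j) -> exists2 n', (n < n')%N & D k z' n'.
    move=> [j zj]; exists (maxn n.+1 (absz j)); first exact: leq_maxl.
    move=> y' ty' fy'; exists j; first exact: leq_maxr.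
    by rewrite (finj y' y) ?inE ?fy.
  have [x [a [b [Mx ha hb ab]]]] := occ z n 0%N Mz.
  have [/Dk[n' nn' Dn']|/forallNP h1] :=
      pselect (exists j, shift (cell a 0) x (cell j 0) <> y j).
    exists (shift (cell a 0) x), n'; split=> //; first exact: (minimal_shift hM).
    exact: agree_sym.
  have [/Dk[n' nn' Dn']|/forallNP h2] :=
      pselect (exists j, shift (cell b 0) x (cell j 0) <> y j).
    exists (shift (cell b 0) x), n'; split=> //; first exact: (minimal_shift hM).
    exact: agree_sym.
  have sh (c j : int) : shift (cell c 0) x (cell j 0) = row0 x (j + c).
    by congr x; apply: eq_cell; rewrite !coE ?addr0.
  have x00 : row0 x = fun=> o.
    apply: per; first exact: trace_row0.
    exists (b - a); first by apply/eqP; lia.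
    apply/funext => j; rewrite /shift.
    have e1 := contrapT (h1 (j - a)); have e2 := contrapT (h2 (j - a)).
    rewrite !sh in e1 e2; rewrite subrK in e1.
    by rewrite e1 -e2; congr (row0 x _); lia.
  case: z0; rewrite -ha ?distxx //.
  have <- : cell 0 0 = 0 by apply: eq_cell; rewrite !coE.
  by rewrite sh x00.
have [n _ h] := hx (f (row0 x)).
by have [j _ ] := h _ (trace_row0 Mx) erefl.
Qed.

Context (rows_finite : sparse o (trace M)).

Lemma finite_strip x (H : nat) : M x ->
  finite_set [set c | (absz (yco c) <= H)%N /\ x c <> o].
Proof.
move=> Mx.
apply: (@sub_finite_set _ _ (\bigcup_(i in [set i : int | (absz (i - 0) <= H)%N])
  (cell^~ i @` Defs.support o (fun j => x (cell j i))))); last first.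
  apply: bigcup_finite => [|i _]; first exact: finite_int_ball.
  by apply: finite_image; apply: rows_finite; exists x => //; exists i.
move=> c [hc xc]; exists (yco c) => /=; first by rewrite subr0.
by exists (xco c); rewrite /Defs.support /= cell_xyco.
Qed.

(** Otherwise fusion keeps adding nonzero cells to one strip, whose rows
    are finite. *)
Lemma exists_clean_strip (H : nat) : exists z nu, [/\ M z, z 0 <> o &
  forall z', M z' -> agree nu z z' ->
  forall c, (absz (yco c) <= H)%N -> z' c <> o -> (dist c 0 <= nu)%N].
Proof.
apply: contrapT => h.
pose D k z n := exists c : Zd 2,
  [/\ (absz (yco c) <= H)%N, (k < dist c 0 <= n)%N & z c <> o].
have [||x Mx hx] := @minimal_fusion _ _ _ _ hM D.
- move=> k z z' n a [c [h1 h2 h3]]; exists c; split=> //.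
  by rewrite -a //; case/andP: h2.
- move=> k z n Mz z0; apply: contrapT => h'; apply: h.
  exists z, (maxn k n); split=> // z' Mz' a c hc z'c.
  apply: contrapT => /negP; rewrite -ltnNge gtn_max => /andP[h1 h2]; apply: h'.
  exists z', (dist c 0); split=> //; first by apply: agree_le a; exact: leq_maxr.
  by exists c; split=> //; rewrite h1 /=.
have [N hN] := finite_bounded (finite_strip H Mx).
have [n _ [c [h1 /andP[h2 _] h3]]] := hx N.
by have := hN c (conj h1 h3); rewrite leqNgt h2.
Qed.

End SparseTrace.

(** * Connectivity by short steps *)

Section Connectivity.
Local Open Scope ring_scope.
Context (d : nat).
Implicit Types (S : set (Zd d)) (a b c u v w : Zd d) (r : nat).

(** The list is the one used in [r_connected]; a point outside [S] is connected
    to nothing, not even to itself. *)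
Definition conn r S a b := S a /\ exists q : seq (Zd d),
  [/\ path (fun u v => dist u v <= r)%N a q, last a q = b &
      forall w, w \in q -> S w].

Lemma conn_refl r S a : S a -> conn r S a a.
Proof. by move=> Sa; split=> //; exists [::]. Qed.

Lemma conn_trans r S b a c : conn r S a b -> conn r S b c -> conn r S a c.
Proof.
move=> [Sa [q [hq lq Sq]]] [_ [p [hp lp Sp]]]; split=> //; exists (q ++ p).
split; first by rewrite cat_path hq lq.
  by rewrite last_cat lq.
by move=> w; rewrite mem_cat => /orP[/Sq|/Sp].
Qed.

Lemma conn_step r S a b : S a -> S b -> (dist a b <= r)%N -> conn r S a b.
Proof.
move=> Sa Sb ab; split=> //; exists [:: b]; split=> //=; first by rewrite ab.
by move=> w; rewrite inE => /eqP->.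
Qed.

Lemma conn_ind r S (P : Zd d -> Prop) a :
  P a -> (forall u v, conn r S a u -> P u -> S v -> (dist u v <= r)%N -> P v) ->
  forall b, conn r S a b -> P b.
Proof.
move=> Pa Pstep b [Sa [q [hq <- Sq]]].
elim/last_ind: q hq Sq => //= q c IH.
rewrite rcons_path last_rcons => /andP[hq hc] Sq.
have Sq' w : w \in q -> S w by move=> wq; apply: Sq; rewrite mem_rcons inE wq orbT.
apply: Pstep hc; last by apply: Sq; rewrite mem_rcons inE eqxx.
  by split=> //; exists q.
exact: IH.
Qed.

Lemma conn_right r S a b : conn r S a b -> S b.
Proof.
by move=> h; have Sa := h.1; move: b h; apply: conn_ind.
Qed.

Lemma conn_sym r S a b : conn r S a b -> conn r S b a.
Proof.
move=> h; have Sa := h.1; move: b h; apply: conn_ind; first exact: conn_refl.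
move=> u v au ua Sv uv; apply: conn_trans ua; apply: conn_step => //.
  exact: conn_right au.
by rewrite distC.
Qed.

Lemma conn_le r r' S a b : (r <= r')%N -> conn r S a b -> conn r' S a b.
Proof.
move=> rr' h; have Sa := h.1; move: b h; apply: conn_ind; first exact: conn_refl.
move=> u v _ au Sv uv; apply: (conn_trans au).
by apply: conn_step (leq_trans uv rr') => //; exact: conn_right au.
Qed.

Lemma conn_translate r S S' v a b : (forall w, S w -> S' (w + v)) ->
  conn r S a b -> conn r S' (a + v) (b + v).
Proof.
move=> SS' h; have Sa := h.1; move: b h; apply: conn_ind.
  by apply: conn_refl; exact: SS'.
move=> u w au auv Sw uw; apply: (conn_trans auv).
by apply: conn_step; rewrite ?dist_add //; apply: SS' => //; exact: conn_right au.
Qed.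

Definition component r S a : set (Zd d) := [set b | conn r S a b].

(** Every point of a path lies in the component of its origin. *)
Lemma conn_component r S a b : conn r S a b -> conn r (component r S a) a b.
Proof.
move=> h; have Sa := h.1; move: b h; apply: conn_ind.
  by apply: conn_refl; exact: conn_refl.
move=> u v au au' Sv uv; apply: conn_trans au' _; apply: conn_step => //.
by apply: (conn_trans au); apply: conn_step => //; exact: conn_right au.
Qed.

Lemma eq_component r S a b :
  conn r S a b -> component r S a = component r S b.
Proof.
move=> ab; apply/seteqP; split=> c; last exact: conn_trans.
exact/conn_trans/conn_sym.
Qed.

Lemma component_connected r S a : r_connected r (component r S a).
Proof.
move=> u v au av.
have uv : conn r S u v by apply: conn_trans (conn_sym au) av.
have [_ [q [hq lq Sq]]] := conn_component uv.
by exists q; split=> // w /Sq; rewrite (eq_component au).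
Qed.

End Connectivity.

(** * Clusters of a configuration *)

Section Clusters.
Local Open Scope ring_scope.
Context (d : nat) (Sigma : finType) (o : Sigma).
Implicit Types (x z : conf d Sigma) (a b c u v w : Zd d) (r : nat).
Local Notation supp := (Defs.support o).

Definition cluster r x a : pattern d Sigma := fun u =>
  if `[< nbhd r (component r (supp x) a) u >] then Some (x u) else None.

Lemma clusterE r x a u :
  nbhd r (component r (supp x) a) u -> cluster r x a u = Some (x u).
Proof. by move=> h; rewrite /cluster asboolT. Qed.

Lemma dom_cluster r x a : dom (cluster r x a) = nbhd r (component r (supp x) a).
Proof.
by apply/seteqP; split=> u; rewrite /dom /cluster /=; case: asboolP.
Qed.

Lemma component_nbhd r S a u : component r S a u -> nbhd r (component r S a) u.
Proof. by exists u => //; rewrite distxx. Qed.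

Lemma nbhd_component r x a u : nbhd r (component r (supp x) a) u -> x u <> o ->
  component r (supp x) a u.
Proof.
move=> [w aw uw] xu; apply: (conn_trans aw); apply: conn_step => //.
  exact: conn_right aw.
by rewrite distC.
Qed.

Lemma psupport_cluster r x a :
  psupport o (cluster r x a) = component r (supp x) a.
Proof.
apply/seteqP; split=> u; rewrite /psupport dom_cluster /=.
  move=> [h]; rewrite clusterE // => xu.
  by apply: nbhd_component => // e; rewrite e in xu.
move=> h; have hn := component_nbhd h; split=> //.
by rewrite clusterE // => -[e]; have := conn_right h.
Qed.

Lemma cluster_is_cluster r x a : x a <> o -> r_cluster o r (cluster r x a).
Proof.
move=> xa; split.
- by rewrite /r_padded psupport_cluster dom_cluster.
- by rewrite psupport_cluster; exists a; exact: conn_refl.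
- by rewrite psupport_cluster; exact: component_connected.
- move=> u hu; rewrite psupport_cluster -dom_cluster /dom /= hu //.
Qed.

Lemma conn_shift r v x a b :
  conn r (supp (shift v x)) a b <-> conn r (supp x) (a + v) (b + v).
Proof.
split; first exact: conn_translate.
move=> h; rewrite -[a](addrK v) -[b](addrK v).
apply: conn_translate h => w.
by rewrite /Defs.support /shift /= subrK.
Qed.

Lemma cluster_shift r v x a : cluster r (shift v x) a = shift v (cluster r x (a + v)).
Proof.
apply/funext => u; rewrite /cluster [RHS]/shift; congr (if _ then _ else _).
apply: asbool_equiv_eq; split=> -[w aw uw].
  by exists (w + v); [exact/conn_shift|rewrite dist_add].
exists (w - v); last by rewrite -(dist_add v) subrK.
by apply/conn_shift; rewrite subrK.
Qed.

Lemma subcluster r r' x a c : (r <= r')%N -> conn r' (supp x) a c ->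
  subpattern (cluster r x c) (cluster r' x a).
Proof.
move=> rr' ac u; rewrite dom_cluster => h; rewrite !clusterE //.
have [w cw uw] := h; exists w; last exact: leq_trans rr'.
exact: conn_trans ac (conn_le rr' cw).
Qed.

Lemma component_finite r x a : finite_set (component r (supp x) a) ->
  finite_set (dom (cluster r x a)).
Proof.
move=> fS; rewrite dom_cluster.
apply: (@sub_finite_set _ _
  (\bigcup_(w in component r (supp x) a) [set u | (dist u w <= r)%N])).
  by move=> u [w aw uw]; exists w.
by apply: bigcup_finite => // w _; exact: finite_ball.
Qed.

(** A pattern supported by an enumerated finite set is a finite function on
    the indices of the enumeration. *)
Lemma finite_patterns (D : set (Zd d)) : finite_set D ->
  finite_set [set P : pattern d Sigma | dom P `<=` D].
Proof.
move=> /finite_seqP[s hs].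
pose g (f : {ffun 'I_(size s) -> option Sigma}) : pattern d Sigma := fun u =>
  if insub (index u s) is Some k then f k else None.
apply: (@sub_finite_set _ _ (range g)); last exact/finite_image/finite_finset.
move=> P hP; exists [ffun k : 'I_(size s) => P (nth 0 s k)] => //.
apply/funext => u; rewrite /g; case: insubP => [k us ek|us].
  by rewrite ffunE ek nth_index // -index_mem.
rewrite index_mem in us; apply: contrapT => Pu.
have : [set` s] u by rewrite -hs; apply: hP => e; rewrite e in Pu.
by move=> /= h; rewrite h in us.
Qed.

(** The large component is cut into small ones.  The pieces are indexed by
    one representative per small component, since a piece listed twice would
    overlap itself in nonzero cells; padded pieces of distinct components overlap
    only in zeros, because a nonzero cell at distance at most [r] from a component
    belongs to it. *)
Lemma cluster_gluing r r' x a : (r <= r')%N ->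
  finite_set (component r' (supp x) a) ->
  exists (n : nat) (c : 'I_n -> Zd d) (R : pattern d Sigma),
    [/\ forall k, x (c k) <> o,
        zero_gluing o (fun k => cluster r x (c k)) R &
        cluster r' x a = zero_padding o r' R].
Proof.
move=> rr' /finite_seqP[s hs]; set S := component r' (supp x) a in hs *.
have sS u : u \in s <-> S u by move/seteqP: hs => [h1 h2]; split; [exact: h2|exact: h1].
pose rep c := xget 0 (component r (supp x) c).
have repP c : x c <> o -> conn r (supp x) c (rep c).
  move=> xc; apply: (@xgetPex _ 0 (component r (supp x) c)).
  by exists c; exact: conn_refl.
have rep_eq c c' : conn r (supp x) c c' -> rep c = rep c'.
  by move=> /eq_component e; rewrite /rep e.
have Sx c : S c -> x c <> o by move=> /conn_right.
have Sconn c c' : S c -> conn r (supp x) c c' -> S c'.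
  by move=> Sc h; apply: conn_trans Sc _; exact: conn_le h.
pose l := undup (map rep s).
have lP (k : 'I_(size l)) : exists2 c, S c & nth 0 l k = rep c.
  have : nth 0 l k \in l by exact: mem_nth.
  by rewrite mem_undup => /mapP[c /sS Sc ->]; exists c.
pose R : pattern d Sigma := fun u => if `[< nbhd r S u >] then Some (x u) else None.
have domR : dom R = nbhd r S.
  by apply/seteqP; split=> u; rewrite /dom /R /=; case: asboolP.
have RE u : nbhd r S u -> R u = Some (x u) by move=> h; rewrite /R asboolT.
have xl k : x (nth 0 l (k : 'I_(size l))) <> o.
  by have [c Sc ->] := lP k; exact: conn_right (repP _ (Sx _ Sc)).
have sub k : nbhd r (component r (supp x) (nth 0 l (k : 'I_(size l)))) `<=` nbhd r S.
  move=> u [w lw uw]; exists w => //; have [c Sc e] := lP k.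
  by apply: (Sconn _ _ Sc); apply: conn_trans (repP _ (Sx _ Sc)) _; rewrite -e.
exists (size l), (fun k => nth 0 l k), R; split=> //.
- split.
  + rewrite domR; apply/seteqP; split=> u.
      move=> [c Sc uc]; have cl : rep c \in l.
        by rewrite mem_undup; apply: map_f; exact/sS.
      have kl : (index (rep c) l < size l)%N by rewrite index_mem.
      exists (Ordinal kl) => //; rewrite dom_cluster /= nth_index //.
      by exists c => //; apply: conn_sym; apply: repP; exact: Sx.
    by move=> [k _]; rewrite dom_cluster; exact: sub.
  + by move=> k u; rewrite dom_cluster => h; rewrite clusterE // RE //; exact: sub h.
  + move=> k k' u kk'; rewrite !dom_cluster => hk hk'; rewrite !clusterE //.
    suff -> : x u = o by [].
    apply: contrapT => xu.
    have [c Sc e] := lP k; have [c' Sc' e'] := lP k'.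
    have h1 := nbhd_component hk xu; have h2 := nbhd_component hk' xu.
    case/eqP: kk'; apply/val_inj/eqP => /=.
    rewrite -(nth_uniq 0 (ltn_ord k) (ltn_ord k') (undup_uniq _)) e e'.
    apply/eqP/rep_eq; apply: conn_trans (repP _ (Sx _ Sc)) _; rewrite -e.
    apply: (conn_trans h1); apply: conn_sym.
    by apply: conn_trans h2; rewrite e'; exact: repP (Sx _ Sc').
have psR : psupport o R = S.
  apply/seteqP; split=> u; rewrite /psupport domR.
    move=> [h]; rewrite RE // => xu; have [w Sw uw] := h.
    apply: (Sconn _ _ Sw); apply: conn_step; first exact: Sx.
      by move=> e; apply: xu; rewrite e.
    by rewrite distC.
  move=> Su; have hn : nbhd r S u by exists u; rewrite ?distxx.
  by split=> //; rewrite RE // => -[e]; have := Sx _ Su.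
apply/funext => u; rewrite /zero_padding psR /R /cluster -/S.
case: (asboolP (nbhd r S u)) => [h|h].
  rewrite asboolT //; have [w Sw uw] := h; exists w => //; exact: leq_trans rr'.
case: asboolP => // h'; congr Some; apply: contrapT => xu; apply: h.
by exists u; rewrite ?distxx //; exact: nbhd_component xu.
Qed.

End Clusters.

(** * Bounded components give a cluster fractal *)

Section Fractal.
Local Open Scope ring_scope.
Context (d : nat) (Sigma : finType) (o : Sigma) (M : set (conf d Sigma)).
Context (hM : minimal_nonzero o M).
Local Notation supp := (Defs.support o).
Context (bounded : forall r, exists L, forall x, M x -> x 0 <> o ->
  forall b, conn r (supp x) 0 b -> (dist b 0 <= L)%N).
Context (infinite : forall x, M x -> x 0 <> o -> ~ finite_set (supp x)).
Implicit Types (x z : conf d Sigma).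

Lemma finite_component r x : M x -> x 0 <> o ->
  finite_set (component r (supp x) 0).
Proof.
move=> Mx x0; have [L hL] := bounded r.
apply: sub_finite_set (finite_box d L) => b; exact: hL.
Qed.

(** If no such radius existed, a limit would have all its nonzero cells in
    the box that bounds the [r]-components, and would be a finite point. *)
Lemma second_component r : exists R, forall x, M x -> x 0 <> o ->
  exists c, [/\ (dist c 0 <= R)%N, x c <> o & ~ conn r (supp x) 0 c].
Proof.
have [L hL] := bounded r.
apply: contrapT => /forallNP h.
have /choice[w hw] : forall R, exists x, [/\ M x, x 0 <> o &
    forall c, (dist c 0 <= R)%N -> x c <> o -> (dist c 0 <= L)%N].
  move=> R; have /existsNP[x /not_implyP[Mx /not_implyP[x0 hx]]] := h R.
  exists x; split=> // c cR xc; apply: (hL x) => //.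
  by apply: contrapT => nc; apply: hx; exists c.
have [x Mx hx] := @minimal_limit _ _ _ _ hM w (fun k => let: And3 a _ _ := hw k in a).
have x0 : x 0 <> o.
  by have [m _ a] := hx 0%N; rewrite a ?distxx //; case: (hw m).
apply: (infinite Mx x0); apply: sub_finite_set (finite_box d L) => c xc /=.
have [m lem a] := hx (dist c 0).
by have [_ _ hm] := hw m; apply: hm => //; rewrite -a.
Qed.

(** The growth step of the fractal: a radius that reaches both an occurrence
    of every [r]-cluster and a nonzero cell outside the given component also joins
    them to that component. *)
Lemma next_radius r : exists r', (r < r')%N /\
  forall x, M x -> x 0 <> o ->
   (forall z, M z -> z 0 <> o ->
      contains_translate (cluster o r z 0) (cluster o r' x 0)) /\
   exists c, [/\ x c <> o, conn r' (supp x) 0 c & ~ conn r (supp x) 0 c].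
Proof.
have [L hL] := bounded r.
have [R1 hR1] := minimal_recurrence hM (L + r).
have [R2 hR2] := second_component r.
exists (maxn r.+1 (maxn R1 R2)); set r' := maxn _ _.
have rr' : (r < r')%N by exact: leq_maxl.
split=> // x Mx x0; split; last first.
  have [c [cR xc nc]] := hR2 x Mx x0; exists c; split=> //.
  by apply: conn_step => //; rewrite distC /r'; lia.
move=> z Mz z0; have [u uR a] := hR1 z x Mz Mx x0.
exists (shift (- u) (cluster o r z 0)); first by exists (- u).
have zx w : component r (supp z) 0 w -> x (w + u) <> o.
  move=> h; rewrite -[x _]/(shift u x w) a; first exact: conn_right h.
  by apply: leq_trans (hL z Mz z0 _ h) _; exact: leq_addr.
have xu : x u <> o by rewrite -[u]add0r; apply: zx; exact: conn_refl.
move=> w hw.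
have {hw} : dom (cluster o r z 0) (w - u) by [].
rewrite dom_cluster => h; rewrite [RHS]/shift (clusterE h) clusterE.
  congr Some; rewrite -a; first by rewrite /shift subrK.
  have [e he we] := h; rewrite (leq_trans (dist_triangle e _ _)) // addnC.
  by apply: leq_add => //; exact: hL he.
have [e he we] := h; exists (e + u); last first.
  by rewrite -(subrK u w) dist_add; apply: leq_trans we (ltnW rr').
apply: (@conn_trans _ _ _ u).
  by apply: conn_step => //; rewrite distC /r'; lia.
apply: conn_le (ltnW rr') _; rewrite -[u in conn _ _ u _]add0r.
exact: conn_translate zx (conn_component he).
Qed.

(** The clusters of level [i] are the clusters around the origin of the
    configurations of [M]; the translations of the limit are trivial, as the
    cluster of [x] at the origin agrees with [x] on the box of radius [r i >= i]. *)
Lemma minimal_cluster_fractal x : M x -> x 0 <> o -> cluster_fractal o x.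
Proof.
move=> Mx x0; split; first by move=> e; rewrite e in x0.
have /choice[f hf] := next_radius.
pose r i := iter i f 0%N.
have r_lt i : (r i < r i.+1)%N by case: (hf (r i)).
have r_ge i : (i <= r i)%N by elim: i => // i IH; exact: leq_ltn_trans (r_lt i).
pose B i := [set C | exists2 z, M z /\ z 0 <> o & C = cluster o (r i) z 0].
have Btranslate i z c : M z -> z c <> o ->
    exists2 b, B i b & is_translate b (cluster o (r i) z c).
  move=> Mz zc; exists (cluster o (r i) (shift c z) 0).
    exists (shift c z) => //; split; first exact: (minimal_shift hM).
    by rewrite /shift add0r.
  exists (- c); apply/funext => u.
  by rewrite cluster_shift /shift add0r subrK.
exists r, B; split=> //.
- move=> i; split; last first.
    move=> C [z [Mz z0] ->]; split; first exact: cluster_is_cluster.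
    exact/component_finite/finite_component.
  have [L hL] := bounded (r i).
  apply: sub_finite_set (finite_patterns Sigma (finite_box d (L + r i))).
  move=> _ [z [Mz z0] ->] u; rewrite dom_cluster => -[w hw uw] /=.
  rewrite (leq_trans (dist_triangle w _ _)) // addnC.
  by apply: leq_add => //; exact: hL hw.
split.
- move=> i _ [z [Mz z0] ->].
  have [n [c [R [zc gl e]]]] :=
    cluster_gluing (ltnW (r_lt i)) (finite_component (r i.+1) Mz z0).
  by exists n, (fun k => cluster o (r i) z (c k)), R; split=> // k; exact: Btranslate.
- move=> i _ _ [z [Mz z0] ->] [z' [Mz' z'0] ->].
  by have [_ /(_ z Mz z0)[+ _]] := hf (r i); apply.
- move=> i _ [z [Mz z0] ->].
  have [_ /(_ z Mz z0)[_ [c [zc r'c nc]]]] := hf (r i).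
  exists (cluster o (r i) z 0), (cluster o (r i) z c); split.
  + exact: Btranslate.
  + exact: Btranslate.
  + by apply: subcluster (conn_refl _ z0); exact: ltnW.
  + by apply: subcluster r'c; exact: ltnW.
  + rewrite !psupport_cluster; apply/seteqP; split=> // u [h1 h2]; apply: nc.
    exact: conn_trans h1 (conn_sym h2).
exists (fun=> 0), (fun j => cluster o (r j) x 0); split; first by move=> j; exists x.
apply: cvg_agree => n u hu; rewrite /shift addr0 /zero_extension clusterE //.
by exists 0; [exact: conn_refl|exact: leq_trans (r_ge n)].
Qed.

End Fractal.

(** * Connected sets crossing clean strips *)

Section Strand.
Local Open Scope ring_scope.
Implicit Types (S : set (Zd 2)) (a b c e u v w : Zd 2).

Lemma dist_xco n u v : (dist u v <= n)%N -> (absz (xco u - xco v) <= n)%N.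
Proof. by rewrite dist2_leE => /andP[]. Qed.

Lemma dist_yco n u v : (dist u v <= n)%N -> (absz (yco u - yco v) <= n)%N.
Proof. by rewrite dist2_leE => /andP[]. Qed.

(** The discrete intermediate value theorem, for a 1-Lipschitz function. *)
Lemma conn_ivt (f : Zd 2 -> int) r S a b (t : int) :
  (forall u v, (absz (f u - f v) <= dist u v)%N) ->
  conn r S a b -> f a <= t <= f b ->
  exists2 w, conn r S a w & t <= f w <= t + r%:Z.
Proof.
move=> flip h /andP[fa fb]; have Sa := h.1; move: b h fb; apply: conn_ind.
  by move=> fa'; exists a; [exact: conn_refl|lia].
move=> u v au IH Sv uv fv; have [fu|fu] := leP t (f u); first exact: IH.
exists v; last by have := flip u v; lia.
by apply: (conn_trans au); apply: conn_step => //; exact: conn_right au.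
Qed.

Lemma conn_ivt_xco r S a b t : conn r S a b -> xco a <= t <= xco b ->
  exists2 w, conn r S a w & t <= xco w <= t + r%:Z.
Proof. by apply: conn_ivt => u v; exact: dist_xco. Qed.

Lemma conn_ivt_yco r S a b t : conn r S a b -> yco a <= t <= yco b ->
  exists2 w, conn r S a w & t <= yco w <= t + r%:Z.
Proof. by apply: conn_ivt => u v; exact: dist_yco. Qed.

(** [S] stands for the nonzero cells and [K] for the markers, the centres of
    occurrences of a clean strip pattern. *)
Context (r R nu : nat) (S K : set (Zd 2)).
Context (markers_dense :
  forall c, S c -> exists2 u, K u & (dist u c <= R)%N).
Context (markers_clean : forall u, K u ->
  S u /\ forall c, S c -> (absz (yco c - yco u) <= r)%N -> (dist c u <= nu)%N).

Definition strip (lo hi : int) : set (Zd 2) := [set c | S c /\ lo <= yco c <= hi].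

(** The first factor counts the heights at which a marker near a strip of
    height [T] can lie; columns separated by the second one have markers more than
    [nu] apart. *)
Definition width_bound (rho T : nat) := ((T + R.*2).+1 * (rho + nu + R.*2).+1)%N.

(** A connected set that is too wide meets many columns far from each other.
    The markers near these crossing points lie in a bounded range of heights, so two
    of them have the same height and are close, a contradiction. *)
Lemma conn_width rho T lo hi a b : hi - lo <= T%:Z ->
  conn rho (strip lo hi) a b -> (absz (xco a - xco b) <= width_bound rho T)%N.
Proof.
move=> hT; wlog ab : a b / xco a <= xco b.
  move=> hwlog h; have [ab|/ltW ba] := leP (xco a) (xco b); first exact: hwlog.
  by rewrite distnC; apply: hwlog ba (conn_sym h).
move=> h; apply: contrapT => hw.
set N := (T + R.*2).+1; set D := (rho + nu + R.*2).+1.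
have {}hw : xco a + N%:Z * D%:Z < xco b.
  by move/negP: hw; rewrite -ltnNge /width_bound -/N -/D; clearbody N D; lia.
have H (k : 'I_N.+1) : exists wu : Zd 2 * Zd 2,
    [/\ lo <= yco wu.1 <= hi, xco a + k%:Z * D%:Z <= xco wu.1,
        xco wu.1 <= xco a + k%:Z * D%:Z + rho%:Z, K wu.2 &
        (dist wu.2 wu.1 <= R)%N].
  have kN : k%:Z <= N%:Z by have := ltn_ord k; lia.
  have [|w aw /andP[h1 h2]] := @conn_ivt_xco _ _ _ _ (xco a + k%:Z * D%:Z) h.
    by nia.
  have [Sw hy] := conn_right aw; have [u Ku uw] := markers_dense Sw.
  by exists (w, u).
have /choice[f hf] := H.
pose g (k : 'I_N.+1) : 'I_N := inord (absz (yco (f k).2 - lo + R%:Z)).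
have gE k : (g k : nat)%:Z = yco (f k).2 - lo + R%:Z.
  have [h1 _ _ _ /dist_yco h2] := hf k.
  rewrite inordK; lia.
have ginj : injective g.
  move=> k l e.
  have [_ k1 k2 Kk dk] := hf k; have [_ l1 l2 Kl dl] := hf l.
  have ey : yco (f k).2 = yco (f l).2.
    by have := gE k; have := gE l; rewrite e; lia.
  have dkl : (dist (f k).2 (f l).2 <= nu)%N.
    by apply: (markers_clean Kl).2 (markers_clean Kk).1 _; rewrite ey subrr.
  move/dist_xco: dkl; move/dist_xco: dk; move/dist_xco: dl => dl dk dkl.
  apply/val_inj => /=; move: k1 k2 l1 l2 dk dl dkl.
  move: (xco (f k).1) (xco (f k).2) (xco (f l).1) (xco (f l).2) => x1 x2 x3 x4.
  case: (ltngtP k l) => // kl k1 k2 l1 l2 dk dl dkl.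
    have : (k.+1 * D <= l * D)%N by rewrite leq_mul2r kl orbT.
    by nia.
  have : (l.+1 * D <= k * D)%N by rewrite leq_mul2r kl orbT.
  by nia.
by have := leq_card _ ginj; rewrite !card_ord ltnn.
Qed.

(** A path between two cells of the window may leave it, but only through the
    clean strips at its top and bottom, and must return through the same strip;
    each excursion can be replaced by a jump of length at most twice [nu]. *)
Lemma conn_window lo hi up dn a b :
  K up -> yco up = hi -> K dn -> yco dn = lo -> lo + r%:Z <= hi ->
  lo <= yco a <= hi -> lo <= yco b <= hi ->
  conn r S a b -> conn (maxn r nu.*2) (strip lo hi) a b.
Proof.
move=> Kup yup Kdn ydn lohi ha hb h; have Sa := h.1.
pose C v := conn (maxn r nu.*2) (strip lo hi) a v.
(* The path is followed by its last cell in the window; outside the window, that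
   cell lies in the clean strip through which the path has left. *)
pose P v := [\/ lo <= yco v <= hi /\ C v,
  hi < yco v /\ exists2 e, C e & hi - r%:Z <= yco e <= hi |
  yco v < lo /\ exists2 e, C e & lo <= yco e <= lo + r%:Z].
suff : P b by case=> [[]//|[? _]|[? _]]; lia.
move: b h {hb}; apply: conn_ind.
  by apply: Or31; split=> //; apply: conn_refl; split.
move=> u v _ Pu Sv uv; have uvy := dist_yco uv.
have C_jump m e : K m -> C e -> lo <= yco v <= hi ->
    (absz (yco e - yco m) <= r)%N -> (absz (yco v - yco m) <= r)%N -> C v.
  move=> Km Ce hv em vm; have [Se _] := conn_right Ce.
  apply: (conn_trans Ce); apply: conn_step; first exact: conn_right Ce.
    by split.
  have [_ cl] := markers_clean Km.
  have := cl _ Se em; have := cl _ Sv vm; have := dist_triangle m e v.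
  by rewrite (distC m v); lia.
have [hv|hv] := boolP (lo <= yco v <= hi).
  apply: Or31; split=> //.
  case: Pu => [[hu Cu]|[hu [e Ce he]]|[hu [e Ce he]]].
  - apply: (conn_trans Cu); apply: conn_step; first exact: conn_right Cu.
      by split.
    by apply: leq_trans uv _; exact: leq_maxl.
  - by apply: (C_jump up e) => //; rewrite yup; lia.
  - by apply: (C_jump dn e) => //; rewrite ydn; lia.
have [hv'|hv'] := ltP hi (yco v).
  apply: Or32; split=> //.
  case: Pu => [[hu Cu]|[hu [e Ce he]]|[hu [e Ce he]]].
  - by exists u => //; lia.
  - by exists e.
  - lia.
apply: Or33; split; first lia.
case: Pu => [[hu Cu]|[hu [e Ce he]]|[hu [e Ce he]]].
- by exists u => //; lia.
- lia.
- by exists e.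
Qed.

Definition strip_bound (T : nat) :=
  (width_bound (maxn r nu.*2) (T + 6 * R + 3 * r) + (R + nu).*2)%N.

(** Each nonzero cell of the strip has a marker nearby whose clean strip is
    crossed by the long path, so the cell is close to the path.  Two cells of the
    path in the strip are connected inside a slightly larger window bounded by two
    markers, where [conn_width] applies. *)
Lemma crossing_width (T : nat) (h : int) a b c c' :
  conn r S a b -> yco a <= h - (R.*2 + r)%:Z -> h + T%:Z + (R.*2 + r)%:Z <= yco b ->
  strip h (h + T%:Z) c -> strip h (h + T%:Z) c' ->
  (absz (xco c - xco c') <= strip_bound T)%N.
Proof.
move=> ab ya yb.
have near c0 : strip h (h + T%:Z) c0 -> exists w, [/\ conn r S a w,
    (dist c0 w <= R + nu)%N & h - R%:Z <= yco w <= h + T%:Z + R%:Z + r%:Z].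
  move=> [Sc hc]; have [u Ku uc] := markers_dense Sc; have uy := dist_yco uc.
  have [|w aw hw] := @conn_ivt_yco _ _ _ _ (yco u) ab; first lia.
  exists w; split=> //; last lia.
  have := (markers_clean Ku).2 w (conn_right aw).
  by rewrite (distC w); have := dist_triangle u c0 w; rewrite (distC c0 u); lia.
move=> /near[w [aw cw yw]] /near[w' [aw' cw' yw']].
have [|e ae he] := @conn_ivt_yco _ _ _ _ (h + T%:Z + R.*2%:Z + r%:Z) ab; first lia.
have [up Kup /dist_yco dup] := markers_dense (conn_right ae).
have [|e' ae' he'] := @conn_ivt_yco _ _ _ _ (h - R.*2%:Z - r%:Z) ab; first lia.
have [dn Kdn /dist_yco ddn] := markers_dense (conn_right ae').
have W : conn (maxn r nu.*2) (strip (yco dn) (yco up)) w w'.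
  apply: (conn_window Kup _ Kdn) => //; try lia.
  exact: conn_trans (conn_sym aw) aw'.
have := conn_width (T := T + 6 * R + 3 * r) _ W.
have := dist_xco cw; have := dist_xco cw'; rewrite /strip_bound.
move: (width_bound _ _) => B h1 h2 h3.
suff : (absz (xco w - xco w') <= B)%N by lia.
apply: h3; lia.
Qed.

End Strand.

(** * Unbounded components give a strand *)

Section ExistsStrand.
Local Open Scope ring_scope.
Context (Sigma : finType) (o : Sigma) (M : set (conf 2 Sigma)).
Context (hM : minimal_nonzero o M).
Local Notation supp := (Defs.support o).
Implicit Types (x z : conf 2 Sigma) (c : Zd 2).

(** A thick curve: it meets all strips of height [r], and its part in each strip
    has a width controlled by the height of the strip. *)
Definition strand r x :=
  (forall h : int, exists2 c, x c <> o & h <= yco c <= h + r%:Z) /\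
  (forall T : nat, exists C : nat, forall (h : int) c c',
     x c <> o -> x c' <> o -> h <= yco c <= h + T%:Z -> h <= yco c' <= h + T%:Z ->
     (absz (xco c - xco c') <= C)%N).

Context (hY : sparse o (trace M)) (r : nat).
Context (unbounded : forall L, exists x b, [/\ M x, x 0 <> o,
   conn r (supp x) 0 b & (L < dist b 0)%N]).

(** A component that is long is tall, since inside a strip its width is
    bounded.  Centring tall components at half height and passing to the limit
    gives the conclusion, as both conditions are local and hold near all heights
    that a tall component crosses. *)
Lemma exists_strand : exists2 x, M x /\ x 0 <> o & strand r x.
Proof.
have [z [nu [Mz z0 clean]]] := exists_clean_strip hM hY r.
have [R hR] := minimal_recurrence hM nu.
pose K x := [set u | agree nu (shift u x) z].
have dense x : M x -> forall c, supp x c -> exists2 u, K x u & (dist u c <= R)%N.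
  move=> Mx c xc; have [||u uR a] := hR z (shift c x) Mz.
  - exact: (minimal_shift hM).
  - by rewrite /shift add0r.
  exists (u + c); first by rewrite /K /= -shift_shift.
  by rewrite dist_sub addrK.
have markers x : M x -> forall u, K x u -> supp x u /\
    forall c, supp x c -> (absz (yco c - yco u) <= r)%N -> (dist c u <= nu)%N.
  move=> Mx u Ku; split.
    by rewrite /Defs.support /= -[u]add0r -[x _]/(shift u x 0) Ku // distxx.
  move=> c xc cu; rewrite dist_sub; apply: (clean (shift u x)).
  - exact: (minimal_shift hM).
  - exact: agree_sym.
  - by rewrite !coE.
  - by rewrite /shift subrK.
have long n : exists x a b, [/\ M x, x 0 <> o, conn r (supp x) a 0,
    conn r (supp x) 0 b & yco a <= - n%:Z /\ n%:Z <= yco b].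
  (* A component leaving the rows at distance V of the origin can be recentred
     so as to extend n rows up and down. *)
  pose V := (n.*2 + r)%N.
  have [x [b [Mx x0 ab Lb]]] := unbounded (V + width_bound R nu r (V.*2)).
  have [w aw hw] : exists2 w, conn r (supp x) 0 w & (V < absz (yco w))%N.
    apply: contrapT => hV.
    have V_le w : conn r (supp x) 0 w -> - V%:Z <= yco w <= V%:Z.
      by move=> aw; apply: contrapT => hw; apply: hV; exists w => //; lia.
    have W : conn r (strip (supp x) (- V%:Z) V%:Z) 0 b.
      have h := conn_component ab; rewrite -[0]addr0 -[b]addr0.
      apply: conn_translate h => w hw; rewrite addr0; split; last exact: V_le.
      exact: conn_right hw.
    have hx := conn_width (dense x Mx) (markers x Mx) (T := V.*2) _ W.
    have {}hx : (absz (xco 0 - xco b) <= width_bound R nu r V.*2)%N by apply: hx; lia.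
    move: Lb; rewrite ltnNge dist2_leE => /negP; apply.
    have := V_le b ab; move: hx; rewrite !coE; move: (width_bound _ _ _ _) => B; lia.
  have shiftc e c c' : conn r (supp x) c c' ->
      conn r (supp (shift e x)) (c - e) (c' - e).
    by move=> h; apply/conn_shift; rewrite !subrK.
  have [yw|yw] := leP 0 (yco w).
    have [|e ae he] := @conn_ivt_yco _ _ _ _ n%:Z aw; first by rewrite !coE; lia.
    exists (shift e x), (0 - e), (w - e); rewrite -[X in conn _ _ _ X](subrr e).
    rewrite -[X in conn _ _ X (w - e)](subrr e); split.
    - exact: (minimal_shift hM).
    - by rewrite /shift add0r; exact: conn_right ae.
    - exact: shiftc.
    - by apply/shiftc/(conn_trans _ aw)/conn_sym.
    - by rewrite !coE; lia.
  have [|e ae he] := @conn_ivt_yco _ _ _ _ (- n%:Z - r%:Z) (conn_sym aw).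
    by rewrite !coE; lia.
  exists (shift e x), (w - e), (0 - e); rewrite -[X in conn _ _ _ X](subrr e).
  rewrite -[X in conn _ _ X (0 - e)](subrr e); split.
  - exact: (minimal_shift hM).
  - by rewrite /shift add0r; exact: conn_right ae.
  - exact: shiftc.
  - by apply/shiftc/(conn_trans (conn_sym ae))/conn_sym.
  - by rewrite !coE; lia.
have /choice[w hw] := long.
have [x Mx hx] := minimal_limit hM (fun k : nat =>
  let: ex_intro a (ex_intro b (And5 m _ _ _ _)) := hw k in m).
have x0 : x 0 <> o.
  have [m _ a] := hx 0%N; rewrite a ?distxx //.
  by have [? [? []]] := hw m.
exists x => //; split; last first.
  move=> T; exists (strip_bound r R nu T) => h c c' xc xc' hc hc'.
  have [m lem a] := hx (dist c 0 + dist c' 0 + (absz h + T + (R.*2 + r)))%N.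
  have [a0 [b0 [Mm _ am bm [ya yb]]]] := hw m.
  apply: (crossing_width (dense _ Mm) (markers _ Mm) (conn_trans am bm)
    (h := h)); try lia.
  + by split=> //; rewrite /Defs.support /= -a //; lia.
  + by split=> //; rewrite /Defs.support /= -a //; lia.
move=> h.
pose B := strip_bound r R nu (absz h + r).
have [m lem a] := hx (B + (absz h + (absz h + r) + (R.*2 + r)))%N.
have [a0 [b0 [Mm m0 am bm [ya yb]]]] := hw m.
have [|c ac hc] := conn_ivt_yco (t := h) (conn_trans am bm); first lia.
have xc := conn_right ac.
suff cB : (absz (xco c - xco 0) <= B)%N.
  exists c => //; rewrite a //; move: cB; rewrite dist2_leE !coE.
  by clearbody B; lia.
apply: (crossing_width (dense _ Mm) (markers _ Mm) (conn_trans am bm)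
    (h := Num.min h 0)); try lia.
- by split=> //; lia.
- by split=> //; rewrite !coE; lia.
Qed.

End ExistsStrand.

(** * A strand is a highway *)

Section Highway.
Local Open Scope ring_scope.
Context (Sigma : finType) (o : Sigma) (M : set (conf 2 Sigma)).
Context (hM : minimal_nonzero o M) (r : nat) (x : conf 2 Sigma).
Context (Mx : M x) (strand_x : strand o r x).
Implicit Types (c e t u v w : Zd 2) (h i : int) (j : nat).

(** Widths of strips are bounded, so each strip has a leftmost nonzero column. *)
Lemma exists_left_end : exists C : nat, exists a : int -> int, forall h,
  (exists2 c, x c <> o & h <= yco c <= h + r%:Z /\ xco c = a h) /\
  (forall c, x c <> o -> h <= yco c <= h + r%:Z -> a h <= xco c <= a h + C%:Z).
Proof.
have [NE /(_ r)[C hC]] := strand_x; exists C.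
suff /choice[a ha] : forall h, exists a : int,
    (exists2 c, x c <> o & h <= yco c <= h + r%:Z /\ xco c = a) /\
    (forall c, x c <> o -> h <= yco c <= h + r%:Z -> a <= xco c <= a + C%:Z).
  by exists a.
move=> h; have [c0 xc0 hc0] := NE h.
(* Columns are counted from C to the left of c0, which bounds them below. *)
pose P n := `[< exists2 c, x c <> o & h <= yco c <= h + r%:Z /\
  n%:Z = xco c - xco c0 + C%:Z >].
have exP : exists n, P n.
  by exists C; apply/asboolP; exists c0 => //; split=> //; lia.
have [n /asboolP[c xc [hc nE]] nmin] := ex_minnP exP.
exists (xco c); split; first by exists c.
move=> c' xc' hc'.
have h1 := hC h c c' xc xc' hc hc'; have h2 := hC h c0 c' xc0 xc' hc0 hc'.
have : P (absz (xco c' - xco c0 + C%:Z)).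
  by apply/asboolP; exists c' => //; split=> //; lia.
by move/nmin; lia.
Qed.

(** Index [h * W + j] of the path visits the [j]-th cell of a box attached to
    the leftmost column of the strip at height [h], or the first nonzero cell of that
    box when the [j]-th one is zero.  Cells of consecutive boxes lie in a strip of
    height [r + 1], so steps are bounded, and [r + 1] boxes later the path is above
    the whole strip.  A translation under which the neighbourhood of a cell recurs
    maps the strips, their left ends and thus the enumerations to each other, with
    a shift of indices by a multiple of [W]. *)
Lemma strand_highway : highway o x.
Proof.
have [NE width] := strand_x.
have [C [a ha]] := exists_left_end.
have [C1 hC1] := width r.+1.
pose W := (C.+1 * r.+1)%N.
pose pos h j := cell (a h + (j %% C.+1)%N%:Z) (h + (j %/ C.+1)%N%:Z).
pose nz h j := x (pos h j) != o.
pose first h := find (nz h) (iota 0 W).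
pose q h j := if nz h j then pos h j else pos h (first h).
have row_lt j : (j < W)%N -> (j %/ C.+1 <= r)%N.
  by move=> jW; rewrite -ltnS ltn_divLR // mulnC.
have pos_onto h c : x c <> o -> h <= yco c <= h + r%:Z ->
    exists2 j, (j < W)%N & c = pos h j.
  move=> xc hc; have [_ /(_ c xc hc) hx] := ha h.
  exists (absz (yco c - h) * C.+1 + absz (xco c - a h))%N.
    rewrite /W -[X in (_ < X)%N]mulnC.
    have : ((absz (yco c - h)).+1 * C.+1 <= r.+1 * C.+1)%N by rewrite leq_mul2r; lia.
    by rewrite mulSn; lia.
  have hlt : (absz (xco c - a h) < C.+1)%N by lia.
  by apply: eq_cell; rewrite !coE ?modnMDl ?divnMDl // ?modn_small ?divn_small //; lia.
have has_nz h : has (nz h) (iota 0 W).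
  have [c xc hc] := NE h; have [j jW e] := pos_onto h c xc hc.
  by apply/hasP; exists j; rewrite ?mem_iota // /nz -e; apply/eqP.
have first_lt h : (first h < W)%N.
  by rewrite /first -{2}(size_iota 0 W) -has_find.
have first_nz h : nz h (first h).
  by have := nth_find 0%N (has_nz h); rewrite nth_iota // first_lt.
have q_nz h j : x (q h j) <> o.
  by apply/eqP; rewrite /q; case: ifP => // _; exact: first_nz.
have q_row h j : (j < W)%N -> h <= yco (q h j) <= h + r%:Z.
  move=> jW; rewrite /q; case: ifP => _; rewrite /pos yco_cell.
    by have := row_lt _ jW; move: (j %/ _)%N => k; lia.
  by have := row_lt _ (first_lt h); move: (first h %/ _)%N => k; lia.
have q_onto c : x c <> o -> exists2 j, (j < W)%N & c = q (yco c) j.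
  move=> xc; have [|j jW e] := pos_onto (yco c) c xc; first by lia.
  by exists j; rewrite // /q /nz -e; case: eqP.
have W0 : 0 < W%:Z by [].
pose p i := q (i %/ W%:Z)%Z (absz (i %% W%:Z)%Z).
have pE h j : (j < W)%N -> p (h * W%:Z + j%:Z) = q h j.
  move=> jW; rewrite /p divzMDl ?modzMDl; last by rewrite gt_eqF.
  by rewrite divz_small ?modz_small ?addr0 //=; lia.
have split_index i : exists h j, (j < W)%N /\ i = h * W%:Z + j%:Z.
  exists (i %/ W%:Z)%Z, (absz (i %% W%:Z)%Z).
  have h1 := modz_ge0 i (lt0r_neq0 W0); have h2 := ltz_pmod i W0.
  by split; [lia|rewrite gez0_abs // -divz_eq].
have p_nz i : x (p i) <> o by exact: q_nz.
have next_index h j : (j < W)%N -> exists h' j', [/\ (j' < W)%N,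
    h * W%:Z + j%:Z + 1 = h' * W%:Z + j'%:Z & h <= h' <= h + 1].
  move=> jW; have [jW'|jW'] := ltnP j.+1 W.
    by exists h, j.+1; split=> //; lia.
  by exists (h + 1), 0%N; split; rewrite ?mulrDl ?mul1r //; lia.
exists (maxn C1 r.+1), (fun i => p i - p 0), (p 0).
have vE i : p 0 + (p i - p 0) = p i by rewrite addrC subrK.
have dE i k : p i - p 0 - (p k - p 0) = p i - p k.
  by rewrite opprB addrA subrK.
split.
- split; first by rewrite subrr.
  move=> i; rewrite dist_sub dE -dist_sub PoszD.
  have [h [j [jW ->]]] := split_index i.
  have [h' [j' [j'W -> hh']]] := next_index h j jW.
  rewrite !pE // dist2_leE.
  have y1 := q_row h j jW; have y2 := q_row h' j' j'W.
  have := hC1 h _ _ (q_nz h' j') (q_nz h j).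
  move: (q h' j') (q h j) y1 y2 => u1 u2 y1 y2 hx.
  apply/andP; split; last lia.
  by rewrite (leq_trans (hx _ _)) ?leq_maxl //; lia.
- exists (W * r.+1).-1 => k.
  have -> : k + (W * r.+1).-1%:Z + 1 = k + r.+1%:Z * W%:Z.
    have : (0 < W * r.+1)%N by rewrite muln_gt0 -ltz_nat W0.
    by lia.
  have [h [j [jW ->]]] := split_index k.
  have -> : h * W%:Z + j%:Z + r.+1%:Z * W%:Z = (h + r.+1%:Z) * W%:Z + j%:Z by lia.
  rewrite !pE //.
  have y1 := q_row h j jW; have y2 := q_row (h + r.+1%:Z) j jW.
  rewrite -!/(yco _) !coE; lia.
- apply/seteqP; split=> c.
    move=> xc; have [j jW ->] := q_onto c xc.
    by exists (yco c * W%:Z + j%:Z) => //; rewrite vE pE.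
  by move=> [i _ <-]; rewrite vE; exact: p_nz.
move=> i0 n.
have [h0 [j0 [j0W i0E]]] := split_index i0.
have [h1 [j1 [j1W i1E]]] := split_index (i0 + n%:Z).
pose T := (absz (h1 - h0) + r)%N.
have [CT hCT] := width T.
pose e := p i0.
have xe : x e <> o by exact: p_nz.
have ye : h0 <= yco e <= h0 + r%:Z by rewrite /e i0E pE //; exact: q_row.
pose B := (CT + C + T)%N.
have [R hR] := minimal_recurrence hM B.
(* The box of radius B around e contains all nonzero cells of the rows visited by
   the subword; as CT also bounds the width of the translated rows, these contain
   translates of such cells only. *)
have translate_q t : (forall w, (dist w e <= B)%N -> x (w + t) = x w) ->
    forall h j, h0 <= h <= h1 -> (j < W)%N ->
    q (h + yco t) j = q h j + t /\ x (q h j + t) = x (q h j).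
  move=> xt h j hh jW.
  have xet : x (e + t) <> o by rewrite xt ?distxx.
  have near c : x c <> o -> h <= yco c <= h + r%:Z -> (absz (xco c - xco e) <= CT)%N.
    by move=> xc hc; apply: (hCT h0) => //; rewrite /T; lia.
  have inB c : (absz (xco c - xco e) <= CT + C)%N -> h <= yco c <= h + r%:Z ->
      (dist c e <= B)%N.
    by move=> h2 h3; rewrite dist2_leE /B /T; lia.
  have fwd c : x c <> o -> h <= yco c <= h + r%:Z -> x (c + t) = x c.
    by move=> xc hc; apply: xt; apply: inB => //; have := near c xc hc; lia.
  have bwd c : x c <> o -> h + yco t <= yco c <= h + yco t + r%:Z -> x (c - t) = x c.
    move=> xc hc; rewrite -[in RHS](subrK t c) xt //; apply: inB; last first.
      by rewrite !coE; lia.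
    have := hCT (h0 + yco t) c (e + t) xc xet.
    by rewrite !coE /T => hx; have := hx _ _; lia.
  have [[c xc [hc ca]] amin] := ha h.
  have [[c' xc' [hc' ca']] amin'] := ha (h + yco t).
  have aE : a (h + yco t) = a h + xco t.
    have h2 := amin' (c + t); have h3 := amin (c' - t).
    rewrite fwd // !coE in h2; rewrite bwd // !coE in h3.
    by have := h2 xc; have := h3 xc'; lia.
  have posE k : (k < W)%N -> pos (h + yco t) k = pos h k + t.
    by move=> _; apply: eq_cell; rewrite /pos !coE ?aE; lia.
  have posx k : (k < W)%N -> x (pos h k + t) = x (pos h k).
    move=> kW; apply/xt/inB; rewrite /pos !coE; last first.
      by have := row_lt _ kW; move: (k %/ _)%N => k'; lia.
    have := near c xc hc; have : (k %% C.+1 < C.+1)%N by rewrite ltn_mod.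
    by rewrite ca; move: (k %% _)%N => k'; lia.
  have nzE k : (k < W)%N -> nz (h + yco t) k = nz h k.
    by move=> kW; rewrite /nz posE // posx.
  have firstE : first (h + yco t) = first h.
    by apply: eq_in_find => k; rewrite mem_iota => /andP[_ kW]; exact: nzE.
  split; first by rewrite /q nzE // firstE !posE //; case: ifP.
  by rewrite /q; case: ifP => _; apply: posx.
have translate_p t : (forall w, (dist w e <= B)%N -> x (w + t) = x w) ->
    forall k, (k <= n)%N -> p (i0 + yco t * W%:Z + k%:Z) = p (i0 + k%:Z) + t /\
      x (p (i0 + k%:Z) + t) = x (p (i0 + k%:Z)).
  move=> xt k kn; have [h [j [jW ikE]]] := split_index (i0 + k%:Z).
  have -> : i0 + yco t * W%:Z + k%:Z = (h + yco t) * W%:Z + j%:Z.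
    by rewrite mulrDl; move: (yco t * W%:Z) (h * W%:Z) ikE => *; lia.
  rewrite ikE !pE //; apply: translate_q => //.
  have l1 : h0 * W%:Z < (h + 1) * W%:Z by rewrite mulrDl mul1r; lia.
  have l2 : h * W%:Z < (h1 + 1) * W%:Z by rewrite mulrDl mul1r; lia.
  by rewrite !ltr_pM2r // in l1 l2; lia.
have q_nz0 h : shift (q h 0) x 0 <> o by rewrite /shift add0r.
exists (absz (W%:Z * (1 + r%:Z + R.*2%:Z))) => b.
(* Recurrence is applied at a cell high enough for the shifted index, whose height
   may be off by R, to be at least b. *)
pose D := ((b - i0) %/ W%:Z)%Z; pose hb := D + 1 + R%:Z + yco e.
have [u uR hu] := hR (shift e x) (shift (q hb 0) x)
  (minimal_shift hM e Mx) (minimal_shift hM (q hb 0) Mx) (q_nz0 hb).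
pose t := u + q hb 0%N - e.
have xt w : (dist w e <= B)%N -> x (w + t) = x w.
  move=> we; have := hu (w - e); rewrite -dist_sub => /(_ we).
  rewrite /shift subrK => <-; congr x.
  by rewrite /t addrA addrAC addrA.
exists (i0 + yco t * W%:Z).
  have yb := q_row hb 0%N W0; have := dist_yco uR; rewrite yco0 subr0 => uy.
  have m1 := modz_ge0 (b - i0) (lt0r_neq0 W0); have m2 := ltz_pmod (b - i0) W0.
  have dm := divz_eq (b - i0) W%:Z.
  rewrite -/D in dm; have hbE : hb = D + 1 + R%:Z + yco e by [].
  have t1 : D + 1 <= yco t by rewrite /t !coE; lia.
  have t2 : yco t <= D + (1 + r%:Z + R.*2%:Z) by rewrite /t !coE; lia.
  have t1' : (D + 1) * W%:Z <= yco t * W%:Z by rewrite ler_pM2r.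
  have t2' : yco t * W%:Z <= (D + (1 + r%:Z + R.*2%:Z)) * W%:Z by rewrite ler_pM2r.
  rewrite mulrDl mul1r in t1'; rewrite mulrDl [in X in _ <= _ + X]mulrC in t2'.
  have P0 : 0 <= W%:Z * (1 + r%:Z + R.*2%:Z) by rewrite mulr_ge0 //; lia.
  rewrite gez0_abs //.
  move: (W%:Z * (_ + _)) (D * W%:Z) (yco t * W%:Z) t1' t2' dm P0.
  by move: ((b - i0) %% W%:Z)%Z m1 m2 => *; lia.
move=> k kn; rewrite !vE !dE.
have [e1 e2] := translate_p t xt k (ltnW kn).
have [e3 _] := translate_p t xt k.+1 kn.
have s1 i : i + k.+1%:Z = i + k%:Z + 1 by lia.
rewrite !s1 in e3; rewrite e3 e1 e2; congr pair.
by rewrite opprD addrACA subrr addr0.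
Qed.

End Highway.

Lemma orbit_closure_sub (d : nat) (Sigma : finType) (o : Sigma)
    (M : set (conf d Sigma)) (x : conf d Sigma) :
  minimal_nonzero o M -> M x -> orbit_closure x `<=` M.
Proof.
move=> hM Mx y xy; apply: (minimal_closed hM) => B /xy[_ [[v _ <-] Bv]].
by exists (shift v x); split=> //; exact: (minimal_shift hM).
Qed.

Theorem theorem1p3 (Sigma : finType) (o : Sigma) (X : set (conf 2 Sigma))
  (hX : is_subshift X)
  (hX0 : X <> [set zero_conf 2 o])
  (hY : (forall y, trace X y -> eventually_zero_right o y) \/
        (countable (trace X) /\
         [set y | trace X y /\ periodic y] = [set (fun=> o)])) :
  exists2 x, X x &
    [\/ x <> zero_conf 2 o /\ finite_point o x,
        highway o x |
        cluster_fractal o x /\ sparse o (trace (orbit_closure x))].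
Proof.
have [M MX hM] := exists_minimal_nonzero hX hX0.
have tMX : trace M `<=` trace X by move=> y [x /MX Xx h]; exists x.
have rows_finite : sparse o (trace M).
  apply: (minimal_sparse hM); case: hY => [ez|[cY per]]; [left|right].
    by move=> y /tMX; exact: ez.
  split; first exact: sub_countable (subset_card_le tMX) cY.
  move=> y /tMX ty py.
  by have /seteqP[/(_ y (conj ty py))] := per.
have [[x [Mx x0 fx]]|infinite] :=
    pselect (exists x : conf 2 Sigma, [/\ M x, x 0%R <> o & finite_point o x]).
  exists x; first exact: MX.
  by apply: Or31; split=> // e; rewrite e in x0.
have [bounded|/existsNP[r /forallNP unbounded]] := pselect (forall r, exists L,
    forall x : conf 2 Sigma, M x -> x 0%R <> o ->
    forall b, conn r (Defs.support o x) 0%R b -> (dist b 0%R <= L)%N).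
  have [x Mx x0] := minimal_nontrivial hM.
  exists x; first exact: MX.
  apply: Or33; split.
    apply: (minimal_cluster_fractal hM bounded _ Mx x0) => z Mz z0 fz.
    by apply: infinite; exists z.
  move=> y [z /(orbit_closure_sub hM Mx) Mz h]; apply: rows_finite.
  by exists z.
have [L|x [Mx x0] sx] := @exists_strand _ _ _ hM rows_finite r.
  have /existsNP[x /not_implyP[Mx /not_implyP[x0]]] := unbounded L.
  move=> /existsNP[b /not_implyP[xb /negP]]; rewrite -ltnNge => Lb.
  by exists x, b.
exists x; first exact: MX.
by apply: Or32; exact: (strand_highway hM Mx sx).
Qed.
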